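(* Let $B$ be a unital $*$-algebra over $\mathbf{C}$, let $(A,\mathcal{E})$ be a $B$-valued $*$-noncommutative probability space, let $a\in A$ and let $\theta$ be an automorphism of the $*$-algebra $B$. For $k\ge1$ let $\beta^{(1)}_k,\beta^{(2)}_k:B^{2k-1}\to B$ be the $B$-valued cumulant maps of the pair $(a_1,a_2)=(a,a^* )$ corresponding to the index sequences $(1,2,\ldots,1,2)$ and $(2,1,\ldots,2,1)$ of length $2k$, respectively. Then the following are equivalent: (a) $a$ is $B$-valued R-diagonal and for all $k\ge1$ and all $b_1,\ldots,b_{2k-1}\in B$, $$\mathcal{E}(a^*b_1a\theta(b_2)a^*b_3a\cdots\theta(b_{2k-2})a^*b_{2k-1}a)=\theta\big(\mathcal{E}(a\theta(b_1)a^*b_2a\theta(b_3)a^*\cdots b_{2k-2}a\theta(b_{2k-1})a^* )\big).$$ (b) $a$ is $B$-valued R-diagonal and for all $k\ge1$ and all $b_1,\ldots,b_{2k-1}\in B$, $$\beta^{(2)}_k(b_1,\theta(b_2),b_3,\ldots,\theta(b_{2k-2}),b_{2k-1})=\theta\big(\beta^{(1)}_k(\theta(b_1),b_2,\theta(b_3),\ldots,b_{2k-2},\theta(b_{2k-1}))\big).$$ (c) There exists a $B$-valued $*$-noncommutative probability space $(\widetilde A,\widetilde{\mathcal{E}})$ with elements $p,u\in\widetilde A$ such that (i) $p=p^*$; (ii) $u$ is a Haar unitary that normalizes $B$ and satisfies $u^*bu=\theta(b)$ for all $b\in B$; (iii) $\{u,u^*\}$ and $\{p\}$ are free (over $B$)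 with respect to $\widetilde{\mathcal{E}}$; (iv) the element $up$ has the same $B$-valued $*$-distribution as $a$; (v) the odd moments of $p$ vanish, i.e., for every $k\ge0$ and all $b_1,\ldots,b_{2k}\in B$, $\widetilde{\mathcal{E}}(pb_1pb_2\cdots pb_{2k}p)=0$. (d) There exists a $B$-valued $*$-noncommutative probability space $(\widetilde A,\widetilde{\mathcal{E}})$ with elements $p,u\in\widetilde A$ such that (i)--(iv) of (c) hold. Moreover, in (c) or (d), the even moments of $p$ are given by $$\widetilde{\mathcal{E}}(pb_1pb_2\cdots pb_{2k-1}p)=\mathcal{E}(a^*\theta^{-1}(b_1)ab_2a^*\theta^{-1}(b_3)a\cdots b_{2k-2}a^*\theta^{-1}(b_{2k-1})a)$$ for every $k\ge1$ and all $b_1,\ldots,b_{2k-1}\in B$.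
   Context: A $B$-valued $*$-noncommutative probability space is a pair $(A,\mathcal{E})$ where $A$ is a unital $*$-algebra over $\mathbf{C}$ containing a unitally embedded copy of the $*$-algebra $B$ and $\mathcal{E}:A\to B$ is a $*$-preserving conditional expectation: linear, $\mathcal{E}(b)=b$ for $b\in B$, and $\mathcal{E}(b_1ab_2)=b_1\mathcal{E}(a)b_2$. A unitary $u$ ($u^*u=uu^*=1$) is a Haar unitary if $\mathcal{E}(u^k)=0$ for all $k\ge1$; it normalizes $B$ if $ubu^*\in B$ and $u^*bu\in B$ for all $b\in B$. Subsets $S_1,S_2$ of $A$ are free (over $B$) with respect to $\mathcal{E}$ if, with $A_i$ the subalgebra generated by $B\cup S_i$, $\mathcal{E}(y_1\cdots y_n)=0$ whenever $n\ge1$, $y_k\in A_{i_k}$, $\mathcal{E}(y_k)=0$ and $i_k\ne i_{k+1}$ for all $k$. Two elements have the same $B$-valued $*$-distribution if all $*$-moments $\mathcal{E}(a^{\epsilon(1)}b_1a^{\epsilon(2)}\cdots b_{n-1}a^{\epsilon(n)})$ ($n\ge1$, $\epsilon(i)\in\{1,*\}$, $b_i\in B$) agree. R-diagonality: for $\epsilon\in\{1,*\}^n$, the maximal alternating interval partition $\sigma(\epsilon)$ is the interval partition of $\{1,\ldots,n\}$ whose blocks $V$ are the maximal intervals such that $j,j+1\in V$ implies $\epsilon(j)\neq\epsilon(j+1)$. The element $a$ is $B$-valued R-diagonal if for every $k\ge0$ and $b_1,\ldots,b_{2k}\in B$, $\mathcal{E}(ab_1a^*b_2ab_3a^*\cdots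 b_{2k-2}ab_{2k-1}a^*b_{2k}a)=0$, and for every $n\ge1$, $\epsilon\in\{1,*\}^n$, $b_1,\ldots,b_n\in B$, $$\mathcal{E}\Big(\prod_{V\in\sigma(\epsilon)}\Big(\Big(\prod_{j\in V}a^{\epsilon(j)}b_j\Big)-\mathcal{E}\Big(\prod_{j\in V}a^{\epsilon(j)}b_j\Big)\Big)\Big)=0,$$ all products in order of increasing indices. Cumulants: for a family $(a_i)_{i\in I}$ in $A$ the cumulant maps $\alpha_j:B^{n-1}\to B$ ($j\in I^n$, $n\ge 1$; an element of $B$ if $n=1$) are the $\mathbf{C}$-multilinear maps defined recursively by $\mathcal{E}(a_{j(1)}b_1a_{j(2)}\cdots b_{n-1}a_{j(n)})=\sum_{\pi\in NC(n)}\hat\alpha_j(\pi)[b_1,\ldots,b_{n-1}]$, the sum being over noncrossing partitions of $\{1,\dots,n\}$. Here $\hat\alpha_j(1_n)=\alpha_j$ for the one-block partition $1_n$; if $\pi\ne1_n$, choose an interval block $\{p,\ldots,p+q-1\}$ of $\pi$, let $\pi'\in NC(n-q)$ be $\pi$ with this block removed (renumbered), $j''=(j(p),\ldots,j(p+q-1))$, and $j'$ be $j$ with these entries removed; then $\hat\alpha_j(\pi)[b_1,\ldots,b_{n-1}]$ equals $\hat\alpha_{j'}(\pi')[b_1,\ldots,b_{p-2},b_{p-1}\alpha_{j''}(b_p,\ldots,b_{p+q-2})b_{p+q-1},b_{p+q},\ldots,b_{n-1}]$ if $p\ge2$, $p+q-1<n$; $\hat\alpha_{j'}(\pi')[b_1,\ldots,b_{p-2}]\,b_{p-1}\alpha_{j''}(b_p,\ldots,b_{n-1})$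 if $p\ge2$, $p+q-1=n$; $\alpha_{j''}(b_1,\ldots,b_{q-1})\,b_q\,\hat\alpha_{j'}(\pi')[b_{q+1},\ldots,b_{n-1}]$ if $p=1$, $q<n$. *)

(* Defs.v *)
From HB Require Import structures.
From mathcomp Require Import all_boot all_order all_algebra.
From mathcomp Require Import complex reals zify.

Set Implicit Arguments.
Unset Strict Implicit.
Unset Printing Implicit Defensive.

Import GRing.Theory Num.Theory.
Local Open Scope ring_scope.

HB.mixin Record Algebra_isStarAlgebra (C : numClosedFieldType) A
    of GRing.Algebra C A := {
  star : A -> A;
  starK : involutive star;
  starD : {morph star : x y / x + y};
  starM : forall x y, star (x * y) = star y * star x;
  starZ : forall (c : C) x, star (c *: x) = c^* *: star x
}.

#[short(type="starAlgType")]
HB.structure Definition StarAlgebra (C : numClosedFieldType) :=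
  {A of GRing.Algebra C A & Algebra_isStarAlgebra C A}.

(* [ncp_in] is the unital embedding of B; it is injective by [ncp_E_in]. *)
Record ncpSpace (C : numClosedFieldType) (B : starAlgType C) := NcpSpace {
  ncp_alg :> starAlgType C;
  ncp_in : {lrmorphism B -> ncp_alg};
  ncp_E : {linear ncp_alg -> B};
  ncp_in_star : forall b, ncp_in (star b) = star (ncp_in b);
  ncp_E_star : forall x, ncp_E (star x) = star (ncp_E x);
  ncp_E_in : forall b, ncp_E (ncp_in b) = b;
  ncp_E_bimod : forall b1 x b2,
    ncp_E (ncp_in b1 * x * ncp_in b2) = b1 * ncp_E x * b2
}.
Arguments ncp_in {C B} n.
Arguments ncp_E {C B} n.

(* The list F 1, ..., F n. *)
Definition upto (T : Type) (n : nat) (F : nat -> T) : seq T :=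
  [seq F i | i <- iota 1 n].

(* The list s_i, ..., s_k, where s = s_1, s_2, ...; empty if k = i - 1. *)
Definition slice (T : Type) (s : seq T) (i k : nat) : seq T :=
  take (k.+1 - i) (drop i.-1 s).

Lemma size_slice (T : Type) (s : seq T) i k :
  (0 < i)%N -> (k <= size s)%N -> size (slice s i k) = (k.+1 - i)%N.
Proof. by case: i => [//|i] _; rewrite size_take_min size_drop /=; move: (size s) => n; lia. Qed.

(* Noncrossing partitions of {1, ..., n}; the element i of {1, ..., n} is
   represented by the ordinal i - 1 of 'I_n. *)
Section NoncrossingPartitions.
Variable n : nat.
Implicit Type P : {set {set 'I_n}}.

Definition noncrossing P : bool :=
  [forall V in P, forall W in P, (V != W) ==>
    [forall i in V, forall j in W, forall k in V, forall l in W,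
      ~~ [&& i < j, j < k & k < l]%N]].

Definition NC : {set {set {set 'I_n}}} :=
  [set P | partition P [set: 'I_n] & noncrossing P].

(* The interval {p, ..., p + q - 1} of {1, ..., n}. *)
Definition interval_block (p q : nat) : {set 'I_n} :=
  [set i : 'I_n | (p <= i.+1 < p + q)%N].

(* An interval block {p, ..., p + q - 1} of P, as the pair (p, q). *)
Definition pick_interval_block P : option ('I_n.+1 * 'I_n.+1) :=
  [pick pq : 'I_n.+1 * 'I_n.+1 |
    [&& 0 < pq.1, 0 < pq.2, pq.1 + pq.2 <= n.+1
      & interval_block pq.1 pq.2 \in P]%N].

(* P with the block {p, ..., p + q - 1} removed, renumbered. *)
Definition remove_block P (p q : nat) : {set {set 'I_(n - q)}} :=
  [set [set i : 'I_(n - q) |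
         [exists v in V, val v == if (i.+1 < p)%N then i : nat else (i + q)%N]]
     | V : {set 'I_n} in P :\ interval_block p q].

Lemma pick_interval_block_bounds P pq :
    pick_interval_block P = Some pq ->
  [/\ 0 < pq.1, 0 < pq.2 & pq.1 + pq.2 <= n.+1]%N.
Proof.
by rewrite /pick_interval_block; case: pickP => // pq' /and4P[? ? ? _] [<-].
Qed.

Lemma partition_setT P :
  partition P [set: 'I_n] -> [set: 'I_n] \in P -> P = [set [set: 'I_n]].
Proof.
case/and3P=> _ /trivIsetP tI P0 TP; apply/setP=> V; rewrite inE.
apply/idP/eqP => [VP|-> //]; apply/eqP/negPn/negP => /(tI _ _ VP TP).
by rewrite -setI_eq0 setIT => /eqP V0; rewrite -V0 VP in P0.
Qed.

Lemma pick_interval_block_proper P pq :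
    P \in NC -> P != [set [set: 'I_n]] -> pick_interval_block P = Some pq ->
  (pq.2 < n)%N.
Proof.
rewrite inE => /andP[partP _] nP; rewrite /pick_interval_block.
case: pickP => // pq' /and4P[p0 q0 le_pq VP] [<-]; rewrite ltnNge.
apply: contra nP => le_n; apply/eqP/partition_setT => //.
suff <- : interval_block pq'.1 pq'.2 = [set: 'I_n] by []; move: VP => _.
apply/setP=> i; rewrite !inE; move: (pq'.1) (pq'.2) p0 q0 le_pq le_n.
by case: i => i lti [p ltp] [q ltq] /=; lia.
Qed.

Lemma NC_top : (0 < n)%N -> [set [set: 'I_n]] \in NC.
Proof.
move=> n_gt0; rewrite inE; apply/andP; split.
  apply/and3P; split; first by rewrite /cover big_set1.
    by apply/trivIsetP=> V W /set1P-> /set1P->; rewrite eqxx.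
  by rewrite inE eq_sym -card_gt0 cardsT card_ord.
apply/forall_inP=> V /set1P->; apply/forall_inP=> W /set1P->.
by rewrite eqxx.
Qed.

End NoncrossingPartitions.

Section Defs.
Variables (C : numClosedFieldType) (B : starAlgType C) (A : ncpSpace B).
Local Notation inB := (ncp_in A).
Local Notation E := (ncp_E A).

(* x_1 b_1 x_2 b_2 ... b_(n-1) x_n *)
Fixpoint word (x : seq A) (b : seq B) : A :=
  match x, b with
  | [::], _ => 1
  | x1 :: _, [::] => x1
  | x1 :: x', b1 :: b' => x1 * inB b1 * word x' b'
  end.

Definition mom (x : seq A) (b : seq B) : B := E (word x b).

(* a^1 = a and a^* ; the exponent * is encoded by [true]. *)
Definition spow (a : A) (e : bool) : A := if e then star a else a.

Definition haar_unitary (u : A) : Prop :=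
  [/\ star u * u = 1, u * star u = 1
    & forall k : nat, (0 < k)%N -> E (u ^+ k) = 0].

Definition normalizes (u : A) : Prop :=
  forall b : B, (exists b' : B, u * inB b * star u = inB b')
             /\ (exists b' : B, star u * inB b * u = inB b').

(* The subalgebra of A generated by B and S. *)
Inductive gen_alg (S : A -> Prop) : A -> Prop :=
  | gen_in b : gen_alg S (inB b)
  | gen_set x : S x -> gen_alg S x
  | gen_add x y : gen_alg S x -> gen_alg S y -> gen_alg S (x + y)
  | gen_scale (c : C) x : gen_alg S x -> gen_alg S (c *: x)
  | gen_mul x y : gen_alg S x -> gen_alg S y -> gen_alg S (x * y).

Definition free_over (S1 S2 : A -> Prop) : Prop :=
  forall (n : nat) (y : nat -> A) (i : nat -> bool), (0 < n)%N ->
    (forall k, (1 <= k <= n)%N -> gen_alg (if i k then S2 else S1) (y k)) ->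
    (forall k, (1 <= k <= n)%N -> E (y k) = 0) ->
    (forall k, (1 <= k < n)%N -> i k != i k.+1) ->
  E (\prod_(1 <= k < n.+1) y k) = 0.

(* The maximal runs of consecutive entries of s along which eps alternates. *)
Fixpoint alt_runs (eps : nat -> bool) (s : seq nat) : seq (seq nat) :=
  if s is j :: s' then
    match alt_runs eps s' with
    | (j' :: V) :: sigma =>
        if eps j != eps j' then (j :: j' :: V) :: sigma
        else [:: j] :: (j' :: V) :: sigma
    | _ => [:: [:: j]]
    end
  else [::].

(* The maximal alternating interval partition of {1, ..., n}: its blocks, and
   the elements of each block, are listed in increasing order. *)
Definition alt_partition (n : nat) (eps : nat -> bool) : seq (seq nat) :=
  alt_runs eps (iota 1 n).

Definition r_diagonal (a : A) : Prop :=
  (forall (k : nat) (b : nat -> B),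
     mom (upto (2 * k).+1 (fun i => spow a (~~ odd i))) (upto (2 * k) b) = 0)
  /\
  (forall (n : nat) (eps : nat -> bool) (b : nat -> B), (0 < n)%N ->
     let blk V := \prod_(j <- V) (spow a (eps j) * inB (b j)) in
     E (\prod_(V <- alt_partition n eps) (blk V - inB (E (blk V)))) = 0).

(* The map \hat\alpha_j(P)[b_1, ..., b_(n-1)] determined by the maps alpha.
   Its value does not depend on the choice of the interval blocks. The counter
   m bounds the number of blocks removed, so that m = n suffices. *)
Section PartitionedMap.
Variables (I : Type) (alpha : seq I -> seq B -> B).

Fixpoint hat (m n : nat) (P : {set {set 'I_n}}) (j : seq I) (b : seq B) : B :=
  if m isn't m'.+1 then 0
  else if P == [set [set: 'I_n]] then alpha j b
  else if pick_interval_block P isn't Some (Ordinal p _, Ordinal q _) then 0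
  else
    let P' := remove_block P p q in
    let j'' := slice j p (p + q - 1) in
    let j' := slice j 1 (p - 1) ++ slice j (p + q) n in
    let b_ i := nth 0 b i.-1 in
    if (2 <= p)%N then
      if (p + q - 1 < n)%N then
        hat m' P' j'
          (slice b 1 (p - 2)
           ++ (b_ (p - 1)%N * alpha j'' (slice b p (p + q - 2))
               * b_ (p + q - 1)%N)
           :: slice b (p + q) (n - 1))
      else
        hat m' P' j' (slice b 1 (p - 2))
          * b_ (p - 1)%N * alpha j'' (slice b p (n - 1))
    else
      alpha j'' (slice b 1 (q - 1)) * b_ q
        * hat m' P' j' (slice b q.+1 (n - 1)).

End PartitionedMap.

Section HatExt.
Variables (I : Type) (alpha1 alpha2 : seq I -> seq B -> B).

Lemma hat_ext m n (P : {set {set 'I_n}}) j b :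
    size j = n ->
    (forall j0 b0, (size j0 <= n)%N -> alpha1 j0 b0 = alpha2 j0 b0) ->
  hat alpha1 m P j b = hat alpha2 m P j b.
Proof.
elim: m n P j b => [//|m IHm] n P j b sz_j eq12 /=.
case: ifP => [_|_]; first by rewrite eq12 ?sz_j.
case def_pq: pick_interval_block => [[p q]|] //.
case: p q def_pq => p ltp [q ltq] /pick_interval_block_bounds[/= p0 q0 pq].
have e1 b0 : alpha1 (slice j p (p + q - 1)) b0 = alpha2 (slice j p (p + q - 1)) b0.
  by rewrite eq12 // size_slice ?sz_j; lia.
have e2 b0 : hat alpha1 m (remove_block P p q)
               (slice j 1 (p - 1) ++ slice j (p + q) n) b0
           = hat alpha2 m (remove_block P p q)
               (slice j 1 (p - 1) ++ slice j (p + q) n) b0.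
  apply: IHm => [|j0 b1 le_j0]; last by apply: eq12; lia.
  by rewrite size_cat !size_slice ?sz_j; lia.
by do 2?case: ifP => _; rewrite !(e1, e2).
Qed.

Lemma hat_ext_proper m n (P : {set {set 'I_n}}) j b :
    size j = n -> P \in NC n -> P != [set [set: 'I_n]] ->
    (forall j0 b0, (size j0 < n)%N -> alpha1 j0 b0 = alpha2 j0 b0) ->
  hat alpha1 m P j b = hat alpha2 m P j b.
Proof.
case: m => [//|m] sz_j ncP nP eq12 /=; rewrite (negPf nP).
case def_pq: pick_interval_block => [[p q]|] //.
case: p q def_pq => p ltp [q ltq] def_pq.
have q_lt := pick_interval_block_proper ncP nP def_pq.
have [p0 q0 pq] := pick_interval_block_bounds def_pq; rewrite /= in q_lt p0 q0 pq.
have e1 b0 : alpha1 (slice j p (p + q - 1)) b0 = alpha2 (slice j p (p + q - 1)) b0.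
  by rewrite eq12 // size_slice ?sz_j; lia.
have e2 b0 : hat alpha1 m (remove_block P p q)
               (slice j 1 (p - 1) ++ slice j (p + q) n) b0
           = hat alpha2 m (remove_block P p q)
               (slice j 1 (p - 1) ++ slice j (p + q) n) b0.
  apply: hat_ext => [|j0 b1 le_j0]; last by apply: eq12; lia.
  by rewrite size_cat !size_slice ?sz_j; lia.
by do 2?case: ifP => _; rewrite !(e1, e2).
Qed.

End HatExt.

Section Cumulants.
Variables (I : Type) (f : I -> A).

(* The counter m is a strict bound on the length of j. *)
Fixpoint cumulant_rec (m : nat) (j : seq I) (b : seq B) : B :=
  if m isn't m'.+1 then 0
  else mom (map f j) b
       - \sum_(P in NC (size j) | P != [set [set: 'I_(size j)]])
           hat (cumulant_rec m') (size j) P j b.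

(* The cumulant \alpha_j(b_1, ..., b_(n-1)) of the family f; only meaningful
   when j has length n >= 1 and b has length n - 1. *)
Definition cumulant (j : seq I) (b : seq B) : B := cumulant_rec (size j).+1 j b.

Lemma cumulant_rec_eq m1 m2 j b :
    (size j < m1)%N -> (size j < m2)%N ->
  cumulant_rec m1 j b = cumulant_rec m2 j b.
Proof.
elim: m1 m2 j b => [//|m1 IHm] [//|m2] j b lt1 lt2 /=.
congr (_ - _); apply: eq_bigr => P /andP[ncP nP].
by apply: hat_ext_proper => // j0 b0 lt0; apply: IHm; lia.
Qed.

Lemma moment_cumulant j b :
    (0 < size j)%N ->
  mom (map f j) b = \sum_(P in NC (size j)) hat cumulant (size j) P j b.
Proof.
move=> j_gt0; rewrite (bigD1 [set [set: 'I_(size j)]]) /=; last exact: NC_top.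
rewrite -[hat _ _ [set _] _ _](_ : cumulant j b = _); last first.
  by move: (cumulant) => c; case: (size j) j_gt0 => //= n _; rewrite eqxx.
rewrite [X in _ = X + _]/= -addrA [X in _ = _ + X](_ : _ = 0) ?addr0 //.
rewrite addrC -sumrB big1 // => P /andP[ncP nP].
apply/eqP; rewrite subr_eq0; apply/eqP.
by apply: hat_ext_proper => // j0 b0 lt0; apply: cumulant_rec_eq.
Qed.

End Cumulants.

(* The cumulant maps \beta^(1)_k and \beta^(2)_k of the pair (a_1, a_2) =
   (a, a^* ); the indices 1 and 2 are encoded by [false] and [true]. *)
Definition beta1 (a : A) (k : nat) (b : seq B) : B :=
  cumulant (spow a) (upto (2 * k) (fun i => ~~ odd i)) b.
Definition beta2 (a : A) (k : nat) (b : seq B) : B :=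
  cumulant (spow a) (upto (2 * k) (fun i => odd i)) b.

End Defs.

Definition same_star_distribution (C : numClosedFieldType) (B : starAlgType C)
    (A1 A2 : ncpSpace B) (a1 : A1) (a2 : A2) : Prop :=
  forall (n : nat) (eps : nat -> bool) (b : nat -> B), (0 < n)%N ->
    mom (upto n (fun i => spow a1 (eps i))) (upto (n - 1) b)
    = mom (upto n (fun i => spow a2 (eps i))) (upto (n - 1) b).

(* u p is a polar decomposition with the distribution of a: p is self-adjoint
   and u is a Haar unitary that normalizes B, acts on it by theta and is
   *-free from p. *)
Definition polar_model (C : numClosedFieldType) (B : starAlgType C)
    (A : ncpSpace B) (a : A) (theta : B -> B)
    (At : ncpSpace B) (p u : At) : Prop :=
  [/\ p = star p,
      [/\ haar_unitary u, normalizes u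
        & forall b, star u * ncp_in At b * u = ncp_in At (theta b)],
      free_over (fun x => x = u \/ x = star u) (fun x => x = p)
    & same_star_distribution (u * p : At) a].

(* Main.v *)
Require Import Defs.
From HB Require Import structures.
From mathcomp Require Import all_boot all_order all_algebra.
From mathcomp Require Import boolp functions complex reals zify.

Set Implicit Arguments.
Unset Strict Implicit.
Unset Printing Implicit Defensive.

Import GRing.Theory Num.Theory.
Local Open Scope ring_scope.

(** Two facts carry the proof.

    An R-diagonal element is determined by its alternating moments of even
    length ([r_diagonal_unique]): expanding the centered runs in the defining
    condition expresses the moment of any word with at least two runs through
    moments of shorter words.  An element [u p], where [u] is a Haar unitary
    that normalizes [B] and is free from the self-adjoint element [p], is always
    R-diagonal ([polar_r_diagonal]): in an alternating run the inner unitaries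
    cancel in pairs, and where two runs meet the letter repeats, so that the
    unitaries meeting there have the same sign and freeness applies.  The same
    cancellation turns the even alternating moments of [u p] into even moments
    of [p] ([mom_polar]).  Hence (d) implies (a), and the even moments of [p]
    are the asserted ones.

    For (a) implies (c), the matrix with rows [(0, a^* )] and [(a, 0)] over [A],
    with [B] embedded by [b |-> diag (b, theta^-1 b)], is self-adjoint and has
    the moments required of [p] ([mom_symmetrized_even] and
    [mom_symmetrized_odd]).  It remains to make it free from a Haar unitary that
    implements [theta] ([haar_free_extension]).  Since no positivity is asked
    for, the free product can be built without tensor products and without an
    inner product.  The algebra consists of all pairs of left [B]-linear
    operators on the module of [B]-balanced multilinear functions of words in [u]
    and [p], with the exchange of the components as involution; the expectation
    is the value at the vacuum, averaged over the two components.  Then [u p]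
    and [a] are R-diagonal with the same even alternating moments: for the words
    that start with [a^*] by construction, for the others by the symmetry in
    (a).

    For the equivalence of (a) and (b), consider a noncrossing partition of an
    alternating word.  Odd moments of an R-diagonal element vanish
    ([r_diagonal_odd]), hence so do its odd cumulants, and only partitions with
    blocks of even size contribute.  Removing an interval of even length from
    an alternating word leaves an alternating word, so the recursion for
    [hat] can be followed simultaneously on both sides of the symmetry
    ([hat_twisted]), and moments and cumulants of length [2k] satisfy it
    together, by induction on [k] ([twisted_moments_cumulants]). *)

(** * Alternating lists *)

Section AlternatingLists.

Fixpoint alt (T : Type) (x y : T) (n : nat) : seq T :=
  if n is n'.+1 then x :: alt y x n' else [::].

Fixpoint altmap (T U : Type) (f g : T -> U) (s : seq T) : seq U :=
  if s is x :: s' then f x :: altmap g f s' else [::].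

Lemma size_alt T (x y : T) n : size (alt x y n) = n.
Proof. by elim: n x y => //= n IHn x y; rewrite IHn. Qed.
Lemma size_altmap T U (f g : T -> U) s : size (altmap f g s) = size s.
Proof. by elim: s f g => //= x s IHs f g; rewrite IHs. Qed.
Lemma size_upto T n (F : nat -> T) : size (upto n F) = n.
Proof. by rewrite size_map size_iota. Qed.

Lemma eq_altmap T U (f g f' g' : T -> U) s :
  f =1 f' -> g =1 g' -> altmap f g s = altmap f' g' s.
Proof. by elim: s f g f' g' => //= x s IHs f g f' g' ef eg; rewrite ef (IHs g f g' f'). Qed.
Lemma altmap_id T (s : seq T) : altmap id id s = s.
Proof. by elim: s => //= x s ->. Qed.
Lemma altmap_comp T U V (f g : T -> U) (f' g' : U -> V) s :
  altmap f' g' (altmap f g s) = altmap (f' \o f) (g' \o g) s.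
Proof. by elim: s f g f' g' => //= x s IHs f g f' g'; rewrite IHs. Qed.

Lemma map_alt T U (h : T -> U) x y n : map h (alt x y n) = alt (h x) (h y) n.
Proof. by elim: n x y => //= n IHn x y; rewrite IHn. Qed.

Lemma map_parity T U (b : nat -> T) (f g : T -> U) m n :
  [seq (if odd i then f (b i) else g (b i)) | i <- iota m n]
  = if odd m then altmap f g (map b (iota m n)) else altmap g f (map b (iota m n)).
Proof.
elim: n m => [|n IHn] m /=; first by case: odd.
by have := IHn m.+1; rewrite /=; case: odd => //= ->.
Qed.

(** Lists given by the parity of the index become structurally recursive, as
    the inductions on words require. *)
Lemma upto_altmap T U n (b : nat -> T) (f g : T -> U) :
  upto n (fun i => if odd i then f (b i) else g (b i)) = altmap f g (upto n b).
Proof. exact: map_parity. Qed.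

Lemma upto_alt T n (x y : T) :
  upto n (fun i => if odd i then x else y) = alt x y n.
Proof.
rewrite (upto_altmap n id (fun=> x) (fun=> y)) /upto.
by elim: n x y 1%N => //= n IHn x y m; rewrite IHn.
Qed.
Lemma upto_const T n (x : T) : upto n (fun=> x) = alt x x n.
Proof. by rewrite -upto_alt; apply: eq_map => i; rewrite if_same. Qed.

Lemma upto_nth T (s : seq T) x0 : upto (size s) (fun i => nth x0 s i.-1) = s.
Proof.
rewrite /upto -[in iota 1 _](addn0 1%N) iotaDl -map_comp.
by rewrite -[RHS](mkseq_nth x0).
Qed.

Lemma altmap_cat T U (f g : T -> U) s t :
  altmap f g (s ++ t) = altmap f g s ++ (if odd (size s) then altmap g f t else altmap f g t).
Proof. by elim: s f g => //= x s IHs f g; rewrite IHs /=; case: odd. Qed.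
Lemma altmap_take T U (f g : T -> U) k s : altmap f g (take k s) = take k (altmap f g s).
Proof. by elim: s f g k => [|x s IHs] f g [|k] //=; rewrite IHs. Qed.
Lemma altmap_drop T U (f g : T -> U) k s :
  drop k (altmap f g s) = if odd k then altmap g f (drop k s) else altmap f g (drop k s).
Proof.
elim: s f g k => [|x s IHs] f g [|k] //=; first by case: odd.
by rewrite IHs; case: odd.
Qed.
Lemma alt_take T (x y : T) k n : take k (alt x y n) = alt x y (minn k n).
Proof. by elim: n x y k => [|n IHn] x y [|k] //=; rewrite ?minnSS ?IHn. Qed.
Lemma alt_drop T (x y : T) k n :
  drop k (alt x y n) = if odd k then alt y x (n - k) else alt x y (n - k).
Proof.
elim: n x y k => [|n IHn] x y [|k] //=; first by case: odd.
by rewrite IHn subSS; case: odd.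
Qed.
Lemma alt_cat T (x y : T) k n : 
  alt x y (k + n) = alt x y k ++ (if odd k then alt y x n else alt x y n).
Proof. by elim: k x y => //= k IHk x y; rewrite IHk; case: odd. Qed.
Lemma rev_alt T (x y : T) n : rev (alt x y n) = if odd n then alt x y n else alt y x n.
Proof.
elim: n x y => //= n IHn x y; rewrite rev_cons IHn -cats1.
have := alt_cat x y n 1; have := alt_cat y x n 1.
by rewrite !addn1 /=; case: odd => /= yE xE; rewrite ?yE ?xE.
Qed.
Lemma last_alt T (x y z : T) n : last z (alt x y n.+1) = if odd n then y else x.
Proof. by elim: n x y z => //= n IHn x y z; rewrite (IHn y x x); case: odd. Qed.
Lemma sorted_alt (T : eqType) (x y : T) n :
  x != y -> sorted (fun z1 z2 => z1 != z2) (alt x y n).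
Proof.
case: n => //= n; elim: n x y => //= n IHn x y xy.
by rewrite xy IHn // eq_sym.
Qed.
Lemma nth_altmap T U (f g : T -> U) x0 y0 s i : (i < size s)%N ->
  nth y0 (altmap f g s) i = (if odd i then g else f) (nth x0 s i).
Proof. by elim: s f g i => [|x s IHs] f g [|i] //= lti; rewrite IHs //; case: odd. Qed.
End AlternatingLists.

(** * Involutions and conditional expectations *)
Section StarTheory.
Variables (C : numClosedFieldType) (A : starAlgType C).
Implicit Types x y : A.
Lemma star0 : star (0 : A) = 0.
Proof. by apply: (addrI (star 0)); rewrite -starD !addr0. Qed.
Lemma starN x : star (- x) = - star x.
Proof. by apply: (addrI (star x)); rewrite -starD !subrr star0. Qed.
Lemma star1 : star (1 : A) = 1.
Proof. by rewrite -[LHS]mulr1 -{2}(starK 1) -starM mulr1 starK. Qed.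
End StarTheory.
Section ExpectationTheory.
Variables (C : numClosedFieldType) (B : starAlgType C) (A : ncpSpace B).
Local Notation inB := (ncp_in A).
Local Notation E := (ncp_E A).

Lemma ncp_E1 : E 1 = 1.
Proof. by rewrite -(rmorph1 inB) ncp_E_in. Qed.
Lemma ncp_EMl b x : E (inB b * x) = b * E x.
Proof. by rewrite -[_ * x]mulr1 -(rmorph1 inB) ncp_E_bimod mulr1. Qed.
Lemma ncp_EMr x b : E (x * inB b) = E x * b.
Proof. by rewrite -[x]mul1r -{1}(rmorph1 inB) ncp_E_bimod mul1r mul1r. Qed.

Definition center (x : A) : A := x - inB (E x).

Lemma center_E x : E (center x) = 0.
Proof. by rewrite raddfB /= ncp_E_in subrr. Qed.
Lemma centerD x y : center (x + y) = center x + center y.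
Proof. by rewrite /center raddfD /= raddfD opprD addrACA. Qed.
Lemma centerMl b x : center (inB b * x) = inB b * center x.
Proof. by rewrite /center ncp_EMl rmorphM mulrBr. Qed.
Lemma centerMr x b : center (x * inB b) = center x * inB b.
Proof. by rewrite /center ncp_EMr rmorphM mulrBl. Qed.
Lemma centerZ c x : center (c *: x) = c *: center x.
Proof. by rewrite /center [E _]linearZ [inB _]linearZ scalerBr. Qed.
Lemma center_id x : E x = 0 -> center x = x.
Proof. by rewrite /center => ->; rewrite raddf0 subr0. Qed.
Lemma center_in b : center (inB b) = 0.
Proof. by rewrite /center ncp_E_in subrr. Qed.
End ExpectationTheory.

(** * Freeness in terms of words *)
Section FreeList.
Variables (C : numClosedFieldType) (B : starAlgType C) (A : ncpSpace B).
Variables S1 S2 : A -> Prop.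
Local Notation E := (ncp_E A).

(** The tag of a letter tells which of the two algebras it is taken from;
    [true] stands for the one generated by [S2]. *)
Definition reduced_list (s : seq (bool * A)) : Prop :=
  (forall z, z \in s -> gen_alg (if z.1 then S2 else S1) z.2 /\ E z.2 = 0)
  /\ sorted (fun z1 z2 => z1.1 != z2.1) s.

(** Lists can be extended by a letter at the end, which is how freeness is
    used and proved below. *)
Lemma free_over_listP :
  free_over S1 S2 <->
  forall s, s != [::] -> reduced_list s -> E (\prod_(z <- s) z.2) = 0.
Proof.
split=> [free s s_nil [s_gen s_alt]|free n y i n_gt0 y_gen y_E alt].
  pose z0 : bool * A := (false, 0).
  have s_gt0 : (0 < size s)%N by rewrite lt0n size_eq0.
  have := free (size s) (fun k => (nth z0 s k.-1).2) (fun k => (nth z0 s k.-1).1).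
  rewrite big_add1 /= -(big_nth z0 predT (fun z => z.2)); apply=> //.
  - by move=> [|k] //= lt_k; have [] := s_gen _ (mem_nth z0 lt_k).
  - by move=> [|k] //= lt_k; have [] := s_gen _ (mem_nth z0 lt_k).
  - by move=> [|k] //= lt_k; move/(sortedP z0): s_alt; apply.
have -> : \prod_(1 <= k < n.+1) y k
    = \prod_(z <- [seq (i k, y k) | k <- iota 1 n]) z.2.
  by rewrite big_map /index_iota subSS subn0.
apply: free; first by rewrite -size_eq0 size_map size_iota -lt0n.
split=> [z /mapP[k]|].
  rewrite mem_iota add1n ltnS => lek ->.
  by split; [apply: y_gen|apply: y_E].
rewrite sorted_map; apply/(sortedP 0%N) => k; rewrite size_iota => lt_k /=.
by rewrite !nth_iota ?(ltnW lt_k) //= !add1n; apply: alt.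
Qed.
End FreeList.

(** * R-diagonal elements and their moments *)

Section Runs.
Variable T : Type.
Implicit Types (s V : seq (bool * T)) (t : seq (seq (bool * T))).

Definition alternating s : bool := sorted (fun z1 z2 => z1.1 != z2.1) s.

(** The maximal alternating interval partition, with the letters and the
    coefficients of a word in place of its positions. *)
Fixpoint runs s : seq (seq (bool * T)) :=
  if s is z :: s' then
    match runs s' with
    | (z' :: V) :: sigma =>
        if z.1 != z'.1 then (z :: z' :: V) :: sigma
        else [:: z] :: (z' :: V) :: sigma
    | _ => [:: [:: z]]
    end
  else [::].

Definition first_letter s : bool := head false (unzip1 s).
Definition last_letter s : bool := last false (unzip1 s).

(** Maximality of the runs takes the form of a repeated letter where two of
    them meet. *)
Fixpoint linked t : bool :=
  if t is V :: t' then
    [&& ~~ nilp V, alternating V,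
        (if t' is V' :: _ then first_letter V' == last_letter V else true) & linked t']
  else true.

Lemma runs_alt_runs eps (b : nat -> T) (s : seq nat) :
  runs [seq (eps j, b j) | j <- s]
  = [seq [seq (eps j, b j) | j <- W] | W <- alt_runs eps s].
Proof.
elim: s => //= j s ->; case: alt_runs => [|[|j' V] sigma] //=.
by case: ifP.
Qed.

Lemma flatten_runs s : flatten (runs s) = s /\ linked (runs s).
Proof.
elim: s => //= z s [fl_s]; case: (runs s) fl_s => [|[|z' V] sigma] //=; first by move=> <-.
move=> <- /and3P[alt_V link_V link_sigma].
case: ifP => [zz'|/negbFE zz'] /=.
  split=> //; move: alt_V link_V; rewrite /alternating /last_letter /= zz' => ->.
  by rewrite link_sigma => ->.
by rewrite alt_V link_V link_sigma /first_letter /last_letter /= eq_sym zz'.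
Qed.

Lemma alternating_letters s : alternating s ->
  unzip1 s = alt (first_letter s) (~~ first_letter s) (size s).
Proof.
case: s => //= z s; rewrite /alternating /first_letter /=.
elim: s z => //= z' s IHs z /andP[zz' alt_s]; congr (_ :: _).
by rewrite (IHs _ alt_s); case: z.1 z'.1 zz' => -[].
Qed.
End Runs.

Section Monomials.
Variables (C : numClosedFieldType) (B : starAlgType C) (A : ncpSpace B).
Local Notation inB := (ncp_in A).
Local Notation E := (ncp_E A).

Definition monom (a : A) (s : seq (bool * B)) : A :=
  \prod_(z <- s) (spow a z.1 * inB z.2).

Lemma monom_cat a s t : monom a (s ++ t) = monom a s * monom a t.
Proof. exact: big_cat. Qed.

Lemma monom_word a es bs b : size bs = (size es).-1 -> (0 < size es)%N ->
  monom a (zip es (rcons bs b)) = word (map (spow a) es) bs * inB b.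
Proof.
elim: es bs => // e es IHe [|b' bs] /=.
  by case: es {IHe} => // _ _; rewrite /monom big_seq1.
case: es IHe => // e' es IHe [sz_bs] _.
by rewrite /monom big_cons /= -/(monom a _) IHe //= mulrA.
Qed.

Lemma E_monom a es bs b : size bs = (size es).-1 -> (0 < size es)%N ->
  E (monom a (zip es (rcons bs b))) = mom (map (spow a) es) bs * b.
Proof. by move=> *; rewrite monom_word // ncp_EMr. Qed.

Lemma zip_last (s : seq (bool * B)) : s != [::] ->
  exists bs b, s = zip (unzip1 s) (rcons bs b) /\ size bs = (size (unzip1 s)).-1.
Proof.
move=> s_nil; have [bs [b bsE]] : exists bs b, unzip2 s = rcons bs b.
  by case/lastP: s s_nil => // s z _; exists (unzip2 s), z.2; rewrite /unzip2 map_rcons.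
exists bs, b; rewrite -bsE zip_unzip; split=> //.
by have := congr1 size bsE; rewrite size_rcons !size_map => ->.
Qed.

(** The initial word [s] makes induction possible: expanding the first
    centered run appends that run to [s], or multiplies [s] by a scalar that is
    absorbed in its last coefficient, or taken out of the expectation when [s] is
    empty. *)
Definition run_product (a : A) (s : seq (bool * B)) t : A :=
  monom a s * \prod_(V <- t) center (monom a V).

Lemma r_diagonalP a : r_diagonal a <->
  (forall k bs, size bs = (2 * k)%N -> mom (alt a (star a) (2 * k).+1) bs = 0)
  /\ (forall s, s != [::] -> E (\prod_(V <- runs s) center (monom a V)) = 0).
Proof.
have altE k : upto (2 * k).+1 (fun i => spow a (~~ odd i)) = alt a (star a) (2 * k).+1.
  by rewrite -upto_alt; apply: eq_map => i; case: odd.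
have prodE n eps b : \prod_(V <- alt_partition n eps)
     (\prod_(j <- V) (spow a (eps j) * inB (b j))
      - inB (E (\prod_(j <- V) (spow a (eps j) * inB (b j)))))
   = \prod_(V <- runs [seq (eps j, b j) | j <- iota 1 n]) center (monom a V).
  rewrite runs_alt_runs big_map; apply: eq_bigr => V _.
  by rewrite /center /monom big_map.
split=> [[odd0 run0]|[odd0 run0]]; split=> [k bs|].
- by move=> sz_bs; have := odd0 k (fun i => nth 0 bs i.-1); rewrite altE -sz_bs upto_nth.
- move=> s s_nil; have := run0 (size s) (fun i => (nth (false, 0) s i.-1).1)
    (fun i => (nth (false, 0) s i.-1).2); rewrite lt0n size_eq0 /= => /(_ s_nil).
  rewrite prodE (_ : [seq _ | j <- iota 1 _] = s) //.
  rewrite -[RHS](upto_nth _ (false, 0)); apply: eq_map => j.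
  by rewrite -surjective_pairing.
- by rewrite altE odd0 ?size_upto.
move=> n eps b n_gt0 /=; rewrite prodE run0 //.
by rewrite -size_eq0 size_map size_iota -lt0n.
Qed.

Lemma word_rcons (xs : seq A) bs x b : size xs = (size bs).+1 ->
  word (rcons xs x) (rcons bs b) = word xs bs * inB b * x.
Proof.
elim: xs bs => [|x' xs IHx] [|b' bs] //=; first by case: xs {IHx}.
by move=> [/IHx ->]; rewrite !mulrA.
Qed.

(** Relates the alternating words of odd length that start with [a^*] to those
    that start with [a]. *)
Lemma star_word (xs : seq A) bs : size bs = (size xs).-1 ->
  star (word xs bs) = word (rev (map (@star _ _) xs)) (rev (map (@star _ _) bs)).
Proof.
elim: xs bs => [|x xs IHx] bs; first by rewrite /= star1.
case: xs IHx bs => [|x' xs] IHx [|b bs] // [sz_bs].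
rewrite -[LHS]/(star (x * inB b * word (x' :: xs) bs)) !starM IHx ?sz_bs //.
rewrite -ncp_in_star mulrA (map_cons _ x) (map_cons _ b) !(rev_cons (star _)).
by rewrite word_rcons // size_rcons !size_rev !size_map sz_bs.
Qed.

(** The definition of R-diagonality only mentions the words that start with
    [a]; taking adjoints gives the others. *)
Lemma E_alternating_odd a s : r_diagonal a -> alternating s -> odd (size s) ->
  E (monom a s) = 0.
Proof.
move=> /r_diagonalP[odd0 _] alt_s odd_s.
have s_nil : s != [::] by case: s odd_s {alt_s}.
have [bs [b [sE sz_bs]]] := zip_last s_nil.
have sz_s : size s = (2 * (size s)./2).+1 by lia.
have odd0' bs' : size bs' = size bs -> mom (alt a (star a) (size s)) bs' = 0.
  by move=> sz; rewrite sz_s odd0 // sz sz_bs size_map; lia.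
have -> : E (monom a s) = mom (map (spow a) (unzip1 s)) bs * b.
  by rewrite {1}sE E_monom // size_map lt0n size_eq0.
rewrite (alternating_letters alt_s) map_alt.
suff -> : mom (alt (spow a (first_letter s)) (spow a (~~ first_letter s)) (size s)) bs = 0.
  by rewrite mul0r.
case: first_letter => /=; last exact: odd0'.
rewrite /mom -[word _ _]starK ncp_E_star star_word ?size_alt ?sz_bs ?size_map //.
by rewrite map_alt starK rev_alt odd_s -/(mom _ _) odd0' ?star0 // size_rev size_map.
Qed.

End Monomials.

Section Comparison.
Variables (C : numClosedFieldType) (B : starAlgType C) (A1 A2 : ncpSpace B).
Variables (a1 : A1) (a2 : A2).

Definition same_monoms : Prop :=
  forall s, ncp_E A1 (monom a1 s) = ncp_E A2 (monom a2 s).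

Lemma same_star_distributionP : same_star_distribution a1 a2 <-> same_monoms.
Proof.
split=> [same s|same n eps b n_gt0].
  have [->|s_nil] := eqVneq s [::]; first by rewrite /monom !big_nil !ncp_E1.
  have [bs [b [sE sz_bs]]] := zip_last s_nil.
  have sz_gt0 : (0 < size (unzip1 s))%N by rewrite size_map lt0n size_eq0.
  rewrite sE !E_monom //; congr (_ * _).
  have := same (size (unzip1 s)) (fun i => nth false (unzip1 s) i.-1)
    (fun i => nth 0 bs i.-1) sz_gt0.
  rewrite subn1 -sz_bs upto_nth.
  have mapE (A : ncpSpace B) (a : A) : upto (size (unzip1 s))
     (fun i => spow a (nth false (unzip1 s) i.-1)) = map (spow a) (unzip1 s).
    by rewrite -[unzip1 s in RHS](upto_nth _ false) /upto -map_comp.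
  by rewrite !mapE.
have mapE (A : ncpSpace B) (a : A) :
  upto n (fun i => spow a (eps i)) = map (spow a) (upto n eps).
  by rewrite /upto -map_comp.
have := same (zip (upto n eps) (rcons (upto (n - 1) b) 1)).
by rewrite !E_monom ?size_upto ?subn1 // !mulr1 !mapE.
Qed.

(** Expanding all the centerings gives the plain word and terms that only
    involve moments of shorter words.  If those moments agree for the two
    elements, what has to be subtracted from the product of centered runs to get
    the plain moment is the same for both.  This serves to compute a moment when
    the product is known to vanish, and conversely to transport the vanishing
    from one element to another. *)
Lemma run_product_compare N t s :
    (forall s', (size s' < N)%N ->
      ncp_E A1 (monom a1 s') = ncp_E A2 (monom a2 s')) ->
    (size s + size (flatten t) <= N)%N ->
    (forall V, V \in t -> (0 < size V < N)%N) ->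
  ncp_E A1 (run_product a1 s t) - ncp_E A1 (monom a1 (s ++ flatten t))
  = ncp_E A2 (run_product a2 s t) - ncp_E A2 (monom a2 (s ++ flatten t)).
Proof.
move=> eqN; elim: t s => [|V t IHt] s le_N t_N.
  by rewrite /run_product !big_nil !cats0 !mulr1 !subrr.
have /andP[V_gt0 V_N] := t_N V (mem_head _ _).
have {}t_N W : W \in t -> (0 < size W < N)%N by move=> Wt; apply: t_N; rewrite inE Wt orbT.
rewrite /= size_cat in le_N.
(* The scalar term of the first centering leaves a word shorter than N, since
   V is nonempty. *)
have expand (A : ncpSpace B) (a : A) : run_product a s (V :: t)
    = run_product a (s ++ V) t
      - monom a s * ncp_in A (ncp_E A (monom a V)) * \prod_(W <- t) center (monom a W).
  by rewrite /run_product big_cons mulrA /center mulrBr mulrBl -monom_cat.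
rewrite !expand !raddfB /= [s ++ (V ++ _)]catA [LHS]addrAC [RHS]addrAC.
congr (_ - _); first by apply: IHt; rewrite // size_cat -addnA.
have shorter s' : (size s' + size (flatten t) < N)%N ->
    ncp_E A1 (run_product a1 s' t) = ncp_E A2 (run_product a2 s' t).
  move=> lt_N; have := IHt s' (ltnW lt_N) t_N.
  by rewrite (eqN (s' ++ flatten t)) ?size_cat // => /addIr.
rewrite (eqN V V_N); move: (ncp_E A2 (monom a2 V)) => c.
case/lastP: s {expand} le_N => [|s z] le_N.
  have := shorter [::]; rewrite /run_product /monom !big_nil !mul1r !ncp_EMl => -> //.
  by move: le_N V_gt0 => /=; clear; lia.
have absorb (A : ncpSpace B) (a : A) : monom a (rcons s z) * ncp_in A c
    * \prod_(W <- t) center (monom a W) = run_product a (rcons s (z.1, z.2 * c)) t.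
  by rewrite /run_product /monom -!cats1 !big_cat !big_seq1 rmorphM /= !mulrA.
rewrite !absorb; apply: shorter; rewrite !size_rcons in le_N *.
by apply: leq_trans le_N; rewrite -addnS leq_add2l -add1n leq_add2r.
Qed.

Lemma flatten_size_lt (T : eqType) (t : seq (seq T)) V : (1 < size t)%N ->
  (forall W, W \in t -> (0 < size W)%N) -> V \in t -> (size V < size (flatten t))%N.
Proof.
move=> t_gt1 t_pos Vt; have tE := perm_to_rem Vt.
rewrite size_flatten /shape (perm_sumn (perm_map size tE)) /= -[X in (X < _)%N]addn0 ltn_add2l.
have: (0 < size (rem V t))%N by rewrite size_rem //; case: (size t) t_gt1 => [|[]].
case: (rem V t) (fun W => @mem_rem _ V t W) => // W t' sub _ /=.
by rewrite addn_gt0 t_pos // sub ?mem_head.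
Qed.

Lemma linked_pos (t : seq (seq (bool * B))) : linked t ->
  forall W, W \in t -> (0 < size W)%N.
Proof.
elim: t => //= V t IHt /and4P[V_nil _ _ /IHt pos] W.
by rewrite inE => /predU1P[->|/pos //]; rewrite lt0n.
Qed.

(** Induction on the length of the word: if there are at least two runs,
    each of them is shorter than the word. *)
Lemma same_monoms_r_diagonal :
    (forall s, s != [::] -> ncp_E A1 (\prod_(V <- runs s) center (monom a1 V)) = 0) ->
    (forall s, s != [::] -> ncp_E A2 (\prod_(V <- runs s) center (monom a2 V)) = 0) ->
    (forall s, alternating s -> ncp_E A1 (monom a1 s) = ncp_E A2 (monom a2 s)) ->
  same_monoms.
Proof.
move=> run1 run2 alt12 s; have [N] := ubnP (size s); elim: N s => // N IHN s.
rewrite ltnS => le_sN; have [->|s_nil] := eqVneq s [::].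
  by rewrite /monom !big_nil !ncp_E1.
have [fl_s link_s] := flatten_runs s; have pos := linked_pos link_s.
have [t_gt1|] := ltnP 1 (size (runs s)).
  have := run_product_compare (N := size s) (t := runs s) (s := [::]).
  rewrite /= fl_s add0n /run_product /monom !big_nil !mul1r run1 // run2 // !sub0r.
  move=> cmp; apply: oppr_inj; apply: cmp => // [s' lt_s'|V Vt].
    by apply: IHN; apply: leq_trans lt_s' _.
  by rewrite pos //= -[in X in (_ < X)%N]fl_s flatten_size_lt.
case: (runs s) fl_s link_s => [|V [|//]] /= fl_s; first by rewrite -fl_s in s_nil.
by rewrite cats0 in fl_s; rewrite -fl_s => /and3P[_ alt_V _] _; apply: alt12.
Qed.

Lemma same_monoms_run_product s t : same_monoms ->
  (forall V, V \in t -> (0 < size V)%N) ->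
  ncp_E A1 (run_product a1 s t) = ncp_E A2 (run_product a2 s t).
Proof.
move=> same pos.
have := @run_product_compare (size s + size (flatten t)).+1 t s (fun s' _ => same s').
rewrite same => /(_ (leqnSn _)) cmp; apply: addIr; apply: cmp => V Vt.
rewrite pos //= ltnS (leq_trans _ (leq_addl _ _)) //.
rewrite size_flatten (perm_sumn (perm_map size (perm_to_rem Vt))) /=.
exact: leq_addr.
Qed.

Lemma r_diagonal_transfer : same_monoms -> r_diagonal a1 -> r_diagonal a2.
Proof.
move=> same /r_diagonalP[odd1 run1]; apply/r_diagonalP; split=> [k bs sz_bs|s s_nil].
  have E0 := odd1 k bs sz_bs.
  pose es := alt false true (2 * k).+1.
  have mapE (A : ncpSpace B) (a : A) : map (spow a) es = alt a (star a) (2 * k).+1.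
    exact: map_alt.
  have := same (zip es (rcons bs 1)).
  by rewrite !E_monom ?size_alt // !mulr1 !mapE E0.
have := same_monoms_run_product [::] (t := runs s) same (linked_pos (flatten_runs s).2).
by rewrite /run_product /monom !big_nil !mul1r run1.
Qed.
End Comparison.

Section Uniqueness.
Variables (C : numClosedFieldType) (B : starAlgType C).

Theorem r_diagonal_unique (A1 A2 : ncpSpace B) (a1 : A1) (a2 : A2) :
    r_diagonal a1 -> r_diagonal a2 ->
    (forall n bs, odd n -> size bs = n ->
      mom (alt a1 (star a1) n.+1) bs = mom (alt a2 (star a2) n.+1) bs) ->
    (forall n bs, odd n -> size bs = n ->
      mom (alt (star a1) a1 n.+1) bs = mom (alt (star a2) a2 n.+1) bs) ->
  same_monoms a1 a2.
Proof.
move=> rd1 rd2 eq_false eq_true; have [odd1 run1] := (r_diagonalP a1).1 rd1.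
have [odd2 run2] := (r_diagonalP a2).1 rd2.
apply: same_monoms_r_diagonal => // s alt_s.
have [odd_s|even_s] := boolP (odd (size s)).
  by rewrite !E_alternating_odd.
have [->|s_nil] := eqVneq s [::]; first by rewrite /monom !big_nil !ncp_E1.
have [bs [b [sE sz_bs]]] := zip_last s_nil.
have sz_gt0 : (0 < size (unzip1 s))%N by rewrite size_map lt0n size_eq0.
rewrite {1 2}sE !E_monom // (alternating_letters alt_s) !map_alt; congr (_ * _).
rewrite !size_map in sz_bs sz_gt0.
case: (size s) even_s sz_bs sz_gt0 => // n /negPn odd_n sz_bs _.
by case: first_letter => /=; [apply: eq_true|apply: eq_false].
Qed.

(** The element [- a] satisfies the same condition on runs and has the same
    even alternating moments as [a], hence the same distribution; so an odd
    moment equals its opposite. *)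
Theorem r_diagonal_odd (A : ncpSpace B) (a : A) s :
  r_diagonal a -> odd (size s) -> ncp_E A (monom a s) = 0.
Proof.
move=> rd_a; have [odd0 run0] := (r_diagonalP a).1 rd_a.
have monomN V : monom (- a) V = (-1) ^+ size V *: monom a V.
  have spowN e : spow (- a) e = - spow a e by case: e; rewrite //= starN.
  elim: V => [|z V IHV]; first by rewrite /monom !big_nil scale1r.
  rewrite /monom !big_cons -/(monom _ V) -/(monom _ V) IHV spowN exprS -scalerA.
  by rewrite scaleN1r !mulNr -scalerAr.
have same : same_monoms (- a) a.
  apply: same_monoms_r_diagonal => // [s' s'_nil|s' alt_s'].
    have -> : \prod_(V <- runs s') center (monom (- a) V)
        = (-1) ^+ size (flatten (runs s')) *: \prod_(V <- runs s') center (monom a V).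
      elim: (runs s') => [|W t IHt]; first by rewrite !big_nil scale1r.
      rewrite !big_cons IHt monomN centerZ /= size_cat exprD.
      by rewrite -scalerAl -scalerAr scalerA.
    by rewrite linearZ /= run0 // scaler0.
  rewrite monomN linearZ /=; have [odd_s'|even_s'] := boolP (odd (size s')).
    by rewrite E_alternating_odd // scaler0.
  by rewrite -signr_odd (negPf even_s') scale1r.
move=> odd_s; have := same s; rewrite monomN -signr_odd odd_s scaleN1r raddfN /=.
move/eqP; rewrite eq_sym -addr_eq0 -mulr2n -scaler_nat => /eqP E0.
by rewrite -[LHS]scale1r -(mulVf (_ : 2 != 0 :> C)) ?pnatr_eq0 // -scalerA E0 scaler0.
Qed.
End Uniqueness.

(** * Products of a Haar unitary and a free self-adjoint element *)

Section Polar.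
Variables (C : numClosedFieldType) (B : starAlgType C) (A : ncpSpace B).
Variables (theta : {lrmorphism B -> B}) (thetaV : B -> B).
Hypotheses (thetaK : cancel theta thetaV) (thetaVK : cancel thetaV theta).
Variables (p u : A).
Hypothesis p_star : p = star p.
Hypothesis u_haar : haar_unitary u.
Hypothesis u_conj : forall b, star u * ncp_in A b * u = ncp_in A (theta b).
Hypothesis u_p_free : free_over (fun x => x = u \/ x = star u) (fun x => x = p).
Local Notation inB := (ncp_in A).
Local Notation E := (ncp_E A).
Local Notation Su := (fun x : A => x = u \/ x = star u).
Local Notation Sp := (fun x : A => x = p).
Local Notation reduced := (reduced_list Su Sp).

Lemma uK : star u * u = 1. Proof. by case: u_haar. Qed.
Lemma uVK : u * star u = 1. Proof. by case: u_haar. Qed.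
Lemma in_u b : inB b * u = u * inB (theta b).
Proof. by rewrite -u_conj !mulrA uVK mul1r. Qed.
Lemma u_in b : u * inB b = inB (thetaV b) * u.
Proof. by rewrite in_u thetaVK. Qed.
Lemma us_in b : star u * inB b = inB (theta b) * star u.
Proof. by rewrite -u_conj -!mulrA uVK mulr1. Qed.
Lemma u_conjV b : u * inB b * star u = inB (thetaV b).
Proof. by rewrite u_in -mulrA uVK mulr1. Qed.

Lemma reduced_rcons l t y : reduced l -> last (~~ t) (map fst l) = ~~ t ->
  gen_alg (if t then Sp else Su) y -> E y = 0 -> reduced (rcons l (t, y)).
Proof.
move=> [l_gen l_alt] l_last y_gen y0; split=> [z|].
  by rewrite mem_rcons inE => /predU1P[->|/l_gen].
case: l l_alt l_last {l_gen} => //= z l l_path l_last.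
rewrite rcons_path l_path /=; move: l_last; rewrite last_map => ->.
by case: t {y_gen}.
Qed.

Lemma reduced_E l : l != [::] -> reduced l -> E (\prod_(z <- l) z.2) = 0.
Proof. exact: (free_over_listP Su Sp).1 u_p_free l. Qed.

(** The properties of [u] that are shared by its inverse, so that the two are
    treated together. *)
Definition shifts (v : A) : Prop :=
  [/\ Su v, forall k, E (v ^+ k.+1) = 0
    & forall b, exists b', v * inB b = inB b' * v].

Lemma shifts_u : shifts u.
Proof.
split=> [|k|b]; [by left|by case: u_haar => _ _; apply|].
by exists (thetaV b); apply: u_in.
Qed.
Lemma shifts_us : shifts (star u).
Proof.
split=> [|k|b]; first by right.
  have starX : star (u ^+ k.+1) = star u ^+ k.+1.
    by elim: k => // k IHk; rewrite exprS starM IHk -exprSr.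
  by rewrite -starX ncp_E_star; case: u_haar => _ _ ->; rewrite ?star0.
by exists (theta b); apply: us_in.
Qed.

Lemma gen_expr v k : Su v -> gen_alg Su (v ^+ k.+1).
Proof.
move=> Sv; elim: k => [|k IHk]; first exact: gen_set.
by rewrite exprS; apply: gen_mul => //; apply: gen_set.
Qed.
Lemma shifts_expr v k b : shifts v -> exists b', v ^+ k * inB b = inB b' * v ^+ k.
Proof.
move=> [_ _ v_in]; elim: k b => [|k IHk] b; first by exists b; rewrite mul1r mulr1.
have [b1 b1E] := IHk b; have [b2 b2E] := v_in b1; exists b2.
by rewrite exprS -mulrA b1E mulrA b2E mulrA.
Qed.

(** [z] behaves like a sum of reduced words starting with a positive power of
    [v]: on its left there may be a reduced word that ends in the algebra of
    [p], and further powers of [v], which merge with that first letter.  The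
    condition is on expectations rather than on the form of [z], so it is
    obviously stable under sums. *)
Definition u_tail (v z : A) : Prop := forall l k, reduced l ->
  last true (map fst l) -> E (\prod_(y <- l) y.2 * v ^+ k * z) = 0.
(** The analogue for sums of reduced words that start with a centered element
    of the algebra of [p]. *)
Definition p_tail (z : A) : Prop := forall l, reduced l ->
  ~~ last false (map fst l) -> E (\prod_(y <- l) y.2 * z) = 0.

Lemma reduced_nil : reduced [::]. Proof. by []. Qed.

Lemma u_tail_E v z : u_tail v z -> E z = 0.
Proof. by move=> /(_ [::] 0%N reduced_nil isT); rewrite big_nil !mul1r. Qed.
Lemma p_tail_E z : p_tail z -> E z = 0.
Proof. by move=> /(_ [::] reduced_nil isT); rewrite big_nil mul1r. Qed.

Lemma u_tailD v z1 z2 : u_tail v z1 -> u_tail v z2 -> u_tail v (z1 + z2).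
Proof. by move=> t1 t2 l k rl ll; rewrite mulrDr raddfD /= t1 // t2 // addr0. Qed.

Lemma u_tail_shift v z : u_tail v z -> u_tail v (v * z).
Proof.
move=> vz l k rl ll; rewrite mulrA -[_ * v ^+ k * v]mulrA -exprSr.
exact: vz.
Qed.

(** The scalar moves to the left through the power of [v] and is absorbed by
    the last letter of the word [l], which stays centered. *)
Lemma u_tail_in v b z : shifts v -> u_tail v z -> u_tail v (inB b * z).
Proof.
move=> sv vz l k rl ll; rewrite mulrA -[_ * inB b]mulrA.
have [b' ->] := shifts_expr k b sv; rewrite mulrA.
case/lastP: l rl ll => [|l [t y]] rl ll.
  by rewrite big_nil mul1r -mulrA ncp_EMl; have := vz [::] k rl ll;
    rewrite big_nil mul1r => ->; rewrite mulr0.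
rewrite map_rcons last_rcons /= in ll; rewrite ll {t ll} in rl *.
have [rl_gen rl_alt] := rl.
have y_rl : (true, y) \in rcons l (true, y) by rewrite mem_rcons mem_head.
have /= [y_gen y0] := rl_gen _ y_rl.
rewrite -cats1 big_cat big_seq1 /= -[_ * y * inB b']mulrA.
have := vz (rcons l (true, y * inB b')) k.
rewrite -cats1 big_cat big_seq1 /= map_cat last_cat /= cats1; apply=> //.
split=> [z'|].
  rewrite mem_rcons inE => /predU1P[-> /=|z'l].
    by split; [apply: gen_mul => //; apply: gen_in|rewrite ncp_EMr y0 mul0r].
  by apply: rl_gen; rewrite mem_rcons inE z'l orbT.
by case: l rl_alt {rl rl_gen y_rl} => //= z' l; rewrite !rcons_path.
Qed.

Lemma p_tail_mul v w z : shifts v -> gen_alg Sp w -> E w = 0 -> u_tail v z ->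
  p_tail (w * z).
Proof.
move=> sv w_gen w0 vz l rl ll.
have := vz (rcons l (true, w)) 0%N; rewrite -cats1 big_cat big_seq1 /= mulr1 -mulrA.
rewrite map_cat last_cat cats1; apply=> //; apply: reduced_rcons => //.
exact: negbTE.
Qed.

Lemma p_tail_one w : gen_alg Sp w -> E w = 0 -> p_tail w.
Proof.
move=> w_gen w0 l rl ll; have := @reduced_E (rcons l (true, w)).
rewrite -cats1 big_cat big_seq1 /= cats1; apply; first by case: (l).
by apply: reduced_rcons => //; apply: negbTE.
Qed.

Lemma u_tail_p v z : shifts v -> p_tail z -> u_tail v (v * z).
Proof.
move=> [Sv v0 _] pz l k rl ll; rewrite mulrA -[_ * v ^+ k * v]mulrA -exprSr.
have := pz (rcons l (false, v ^+ k.+1)).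
rewrite -cats1 big_cat big_seq1 /= map_cat last_cat cats1; apply=> //.
by apply: reduced_rcons => //; apply: gen_expr.
Qed.

Lemma u_tail_one v b : shifts v -> u_tail v (v * inB b).
Proof.
move=> [Sv v0 _] l k rl ll; rewrite mulrA -[_ * v ^+ k * v]mulrA -exprSr ncp_EMr.
have := @reduced_E (rcons l (false, v ^+ k.+1)).
rewrite -cats1 big_cat big_seq1 /= cats1 => -> //; first by rewrite mul0r.
  by case: (l).
by apply: reduced_rcons => //; apply: gen_expr.
Qed.

Definition run_left (e : bool) : A := if e then 1 else u.
Definition run_right (e : bool) : A := if e then star u else 1.

Lemma star_up : star (u * p) = p * star u.
Proof. by rewrite starM -p_star. Qed.

Lemma gen_p : gen_alg Sp p. Proof. exact: gen_set. Qed.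

(** Inside a run the unitaries cancel in pairs, as in
    [p u^* b u p = p theta(b) p].  What remains is an element of the algebra of
    [p], preceded by [u] if the first letter is [u p], and followed by [u^*] if
    the last one is [p u^*]. *)
Lemma run_form (V : seq (bool * B)) : ~~ nilp V -> alternating V ->
  exists w, gen_alg Sp w /\
    monom (u * p) V = run_left (first_letter V) * w * run_right (last_letter V).
Proof.
case: V => // z V _; elim: V z => [|z' V IHV] [e b] /=.
  rewrite /monom big_seq1 /=; case: e => _ /=.
    exists (p * inB (theta b)); split; first by apply: gen_mul; [apply: gen_p|apply: gen_in].
    by rewrite star_up mul1r -!mulrA us_in.
  exists (p * inB b); split; first by apply: gen_mul; [apply: gen_p|apply: gen_in].
  by rewrite mulr1 mulrA.
move=> /andP[/= ee' /IHV[w [w_gen wE]]].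
rewrite /monom big_cons -/(monom _ _) wE /=.
rewrite /first_letter /last_letter /= in wE *.
case: e ee' => /= /eqP; case: z'.1 => //= _.
  exists (p * inB (theta b) * w); split.
    by apply: gen_mul => //; apply: gen_mul; [apply: gen_p|apply: gen_in].
  by rewrite star_up !mulrA mul1r -[p * star u * _]mulrA us_in mulrA -[_ * star u * u]mulrA uK mulr1.
exists (p * inB b * w); split; last by rewrite mul1r !mulrA.
by apply: gen_mul => //; apply: gen_mul; [apply: gen_p|apply: gen_in].
Qed.

Lemma center_gen w : gen_alg Sp w -> gen_alg Sp (center w).
Proof.
move=> w_gen; rewrite /center -scaleN1r.
by apply: gen_add => //; apply: gen_scale; apply: gen_in.
Qed.

Lemma split_center w : w = center w + inB (E w).
Proof. by rewrite /center subrK. Qed.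

Lemma E_uw w : gen_alg Sp w -> E (u * w) = 0.
Proof.
move=> w_gen; rewrite [w]split_center mulrDr raddfD /=.
have -> : E (u * center w) = 0.
  apply: (u_tail_E (v := u)); apply: u_tail_p shifts_u _.
  by apply: p_tail_one; [apply: center_gen|apply: center_E].
by rewrite add0r; apply: (u_tail_E (v := u)); apply: u_tail_one shifts_u.
Qed.
Lemma E_wu w : gen_alg Sp w -> E (w * star u) = 0.
Proof.
move=> w_gen; rewrite [w]split_center mulrDl raddfD /=.
have u_one : u_tail (star u) (star u).
  by rewrite -[X in u_tail _ X]mulr1 -(rmorph1 inB); apply: u_tail_one shifts_us.
rewrite (p_tail_E (p_tail_mul shifts_us (center_gen w_gen) (center_E w) u_one)).
by rewrite (u_tail_E (u_tail_in _ shifts_us u_one)) addr0.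
Qed.
Lemma E_uwu w : gen_alg Sp w -> E (u * w * star u) = thetaV (E w).
Proof.
move=> w_gen; rewrite {1}[w]split_center mulrDr mulrDl raddfD /= u_conjV ncp_E_in.
have u_one : u_tail (star u) (star u).
  by rewrite -[X in u_tail _ X]mulr1 -(rmorph1 inB); apply: u_tail_one shifts_us.
have pt := p_tail_mul shifts_us (center_gen w_gen) (center_E w) u_one.
by rewrite -mulrA (u_tail_E (u_tail_p shifts_u pt)) add0r.
Qed.

(** What is known of the product [z] of the centered runs that follow a run
    ending with the letter [e]: the first of them starts with [e] as well, hence
    with [u] if [e] is false, and otherwise with the algebra of [p], after the
    [u^*] at the end of the previous run.  The end of the word is the case
    [z = 1]. *)
Definition good_tail (e : bool) (z : A) : Prop :=
  if e then u_tail (star u) (star u * z) else u_tail u z \/ z = 1.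

Lemma good_tail_one e : good_tail e 1.
Proof.
case: e; last by right.
by rewrite /= -(rmorph1 inB); apply: u_tail_one shifts_us.
Qed.

Lemma good_tail_p w z : gen_alg Sp w -> E w = 0 -> good_tail false z -> p_tail (w * z).
Proof.
move=> w_gen w0 [uz|->]; first exact: p_tail_mul shifts_u w_gen w0 uz.
by rewrite mulr1; apply: p_tail_one.
Qed.
Lemma good_tail_in b z : good_tail false z -> u_tail u (u * (inB b * z)).
Proof.
move=> [uz|->]; first by apply: u_tail_shift; apply: u_tail_in shifts_u uz.
by rewrite mulr1; apply: u_tail_one shifts_u.
Qed.

(** In [u w], [w u^*] and [u w u^*] the element [w] of the algebra of [p] is
    split into its centered part and its expectation.  In [u w u^*], as in a
    bare [w], the expectation of [w] is removed by the centering of the run.  In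
    [u w] it remains, but the factor [u] then merges with the [u] that starts the
    next run; in [w u^*] it remains after the [u^*] that ends the previous run,
    and the two unitaries merge again.  So no unitary ever cancels. *)
Lemma good_tail_run V z : ~~ nilp V -> alternating V ->
    good_tail (last_letter V) z ->
  let z' := center (monom (u * p) V) * z in
  good_tail (first_letter V) z' /\ E z' = 0.
Proof.
move=> V_nil alt_V; have [w [w_gen ->]] := run_form V_nil alt_V => /=.
have c_gen := center_gen w_gen; have c0 := center_E w.
case: (first_letter V) (last_letter V) => -[] /= zP; rewrite ?mul1r ?mulr1.
- rewrite (center_id (E_wu w_gen)) -mulrA.
  rewrite [w]split_center mulrDl.
  have pt := p_tail_mul shifts_us c_gen c0 zP.
  have ut := u_tail_in (E w) shifts_us zP.
  split; last by rewrite raddfD /= (p_tail_E pt) (u_tail_E ut) addr0.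
  by rewrite mulrDr; apply: u_tailD; [apply: u_tail_p shifts_us pt|apply: u_tail_shift].
- have pt := good_tail_p c_gen c0 zP.
  by split; [apply: u_tail_p shifts_us pt|apply: p_tail_E].
- have -> : center (u * w * star u) = u * center w * star u.
    rewrite /center E_uwu // mulrBr mulrBl; congr (_ - _).
    by rewrite u_conjV.
  have pt := p_tail_mul shifts_us c_gen c0 zP.
  rewrite -!mulrA; have ut := u_tail_p shifts_u pt.
  by split; [left|apply: u_tail_E ut].
- rewrite (center_id (E_uw w_gen)) -mulrA [w]split_center mulrDl mulrDr.
  have ut := u_tailD (u_tail_p shifts_u (good_tail_p c_gen c0 zP)) (good_tail_in (E w) zP).
  by split; [left|apply: u_tail_E ut].
Qed.

Lemma polar_r_diagonal : r_diagonal (u * p).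
Proof.
apply/r_diagonalP; split=> [k bs sz_bs|s s_nil].
  pose es := alt false true (2 * k).+1; pose s := zip es (rcons bs 1).
  have sz_s : unzip1 s = es by rewrite /s unzip1_zip // size_rcons size_alt sz_bs.
  have -> : mom (alt (u * p) (star (u * p)) (2 * k).+1) bs = E (monom (u * p) s).
    by rewrite /s E_monom ?size_alt // mulr1 map_alt.
  have s_nil : ~~ nilp s by rewrite /nilp -(size_map fst) -/(unzip1 s) sz_s size_alt.
  have alt_s : alternating s.
    suff: sorted (fun e1 e2 => e1 != e2) (unzip1 s) by rewrite sorted_map.
    by rewrite sz_s sorted_alt.
  have [w [w_gen ->]] := run_form s_nil alt_s.
  have -> : first_letter s = false by rewrite /first_letter sz_s.
  have -> : last_letter s = false.
    by rewrite /last_letter sz_s last_alt mul2n odd_double.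
  by rewrite /= mulr1 E_uw.
have tail t : linked t -> t != [::] ->
   let z := \prod_(V <- t) center (monom (u * p) V) in
   good_tail (first_letter (head [::] t)) z /\ E z = 0.
  elim: t => // V t IHt /= /and4P[V_nil alt_V link link_t] _; rewrite big_cons.
  apply: good_tail_run => //.
  case: t IHt link link_t => [|V' t] IHt link link_t.
    by rewrite big_nil; apply: good_tail_one.
  by have [+ _] := IHt link_t isT; rewrite /= (eqP link).
have [fl_s link_s] := flatten_runs s.
have [] // := tail _ link_s _.
by apply: contra s_nil => /eqP runs0; rewrite -fl_s runs0.
Qed.

Lemma word_gen n bs : gen_alg Sp (word (alt p p n) bs).
Proof.
elim: n bs => [|n IHn] [|b bs] /=.
- by rewrite -(rmorph1 inB); apply: gen_in.
- by rewrite -(rmorph1 inB); apply: gen_in.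
- exact: gen_p.
- by apply: gen_mul => //; apply: gen_mul; [apply: gen_p|apply: gen_in].
Qed.

Lemma word_polar n bs : size bs = n ->
  word (alt (star (u * p)) (u * p) n.+1) bs
    = word (alt p p n.+1) (altmap theta id bs) * (if odd n then 1 else star u)
  /\ word (alt (u * p) (star (u * p)) n.+1) bs
    = u * word (alt p p n.+1) (altmap id theta bs) * (if odd n then star u else 1).
Proof.
elim: n bs => [|n IHn] [|b bs] // => [_|[sz_bs]].
  by rewrite /= star_up mulr1.
have [IH1 IH2] := IHn bs sz_bs.
rewrite -[word (alt (star (u * p)) _ n.+2) _]/(star (u * p) * inB b * word (alt (u * p) (star (u * p)) n.+1) bs).
rewrite -[word (alt (u * p) _ n.+2) _]/(u * p * inB b * word (alt (star (u * p)) (u * p) n.+1) bs).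
rewrite -[word (alt p p n.+2) (altmap theta _ _)]/(p * inB (theta b) * word (alt p p n.+1) (altmap id theta bs)).
rewrite -[word (alt p p n.+2) (altmap id _ _)]/(p * inB b * word (alt p p n.+1) (altmap theta id bs)).
rewrite IH1 IH2 star_up oddS; split; last by case: odd; rewrite /= !mulrA.
rewrite !mulrA -[p * star u * _]mulrA us_in mulrA -[_ * star u * u]mulrA uK mulr1.
by case: odd.
Qed.

Lemma mom_polar n bs : odd n -> size bs = n ->
  mom (alt (star (u * p)) (u * p) n.+1) bs = mom (alt p p n.+1) (altmap theta id bs)
  /\ mom (alt (u * p) (star (u * p)) n.+1) bs
     = thetaV (mom (alt p p n.+1) (altmap id theta bs)).
Proof.
move=> odd_n /word_polar[]; rewrite /mom odd_n => -> ->; rewrite mulr1.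
by split=> //; rewrite E_uwu //; apply: word_gen.
Qed.

End Polar.

(** * Cumulants along alternating words *)

Section Slices.
Lemma mem_slice (T : eqType) (x0 : T) s i k t :
  (i.-1 <= t < k)%N -> (t < size s)%N -> nth x0 s t \in slice s i k.
Proof.
move=> /andP[le_it lt_tk] lt_ts; rewrite /slice.
have -> : nth x0 s t = nth x0 (take (k.+1 - i) (drop i.-1 s)) (t - i.-1).
  by rewrite nth_take ?nth_drop ?subnKC //; lia.
by rewrite mem_nth // size_take_min size_drop; lia.
Qed.

Lemma slice_altmap T U (f g : T -> U) s i k : (0 < i)%N ->
  slice (altmap f g s) i k
  = if odd i then altmap f g (slice s i k) else altmap g f (slice s i k).
Proof.
case: i => // i _; rewrite /slice /= altmap_drop.
by case: odd; rewrite /= altmap_take.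
Qed.

Lemma slice_alt T (x y : T) n i k : (0 < i)%N -> (k <= n)%N ->
  slice (alt x y n) i k = if odd i then alt x y (k.+1 - i) else alt y x (k.+1 - i).
Proof.
case: i => // i _ le_kn; rewrite /slice /= alt_drop subSS.
by case: odd; rewrite /= alt_take (minn_idPl _) // leq_sub2r.
Qed.
End Slices.

Section Hat.
Variables (C : numClosedFieldType) (B : starAlgType C).
Variable I : Type.
Implicit Types (alpha : seq I -> seq B -> B) (j : seq I) (b : seq B).

(** The indices left when the interval from [p] to [p + q - 1] is removed. *)
Definition cut_word p q n j : seq I := slice j 1 (p - 1) ++ slice j (p + q) n.

(** One step of the recursion for [hat].  The removed interval depends on the
    partition alone, so it is the same for all maps and all arguments, which is
    what allows values of [hat] to be compared without knowing that they do not
    depend on the choice of the interval. *)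
Lemma hat_cases m n (P : {set {set 'I_n}}) :
  [\/ P = [set [set: 'I_n]],
      forall alpha j b, hat alpha m.+1 P j b = 0
    | exists p q, [/\ 0 < p, 0 < q & p + q <= n.+1]%N /\
      (P != [set [set: 'I_n]]) /\
      forall alpha j b, hat alpha m.+1 P j b =
        let v := alpha (slice j p (p + q - 1)) in
        let w := hat alpha m (remove_block P p q) (cut_word p q n j) in
        let b_ i := nth 0 b i.-1 in
        if (2 <= p)%N then
          if (p + q - 1 < n)%N then
            w (slice b 1 (p - 2) ++ (b_ (p - 1)%N * v (slice b p (p + q - 2)) * b_ (p + q - 1)%N)
               :: slice b (p + q) (n - 1))
          else w (slice b 1 (p - 2)) * b_ (p - 1)%N * v (slice b p (n - 1))
        else v (slice b 1 (q - 1)) * b_ q * w (slice b q.+1 (n - 1))].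
Proof.
have [->|nP] := eqVneq P [set [set: 'I_n]]; first by constructor 1.
case def_pq: (pick_interval_block P) => [[p q]|]; last first.
  by constructor 2 => alpha j b; rewrite /= (negPf nP) def_pq.
constructor 3; case: p q def_pq => p ltp [q ltq] def_pq.
have [/= p0 q0 pq] := pick_interval_block_bounds def_pq.
exists p, q; split=> //; split=> // alpha j b.
by rewrite /= (negPf nP) def_pq /cut_word.
Qed.

Lemma hat_top alpha m n j b : hat alpha m.+1 [set [set: 'I_n]] j b = alpha j b.
Proof. by rewrite /= eqxx. Qed.

(** The consequence of multilinearity that the recursion for [hat] preserves. *)
Definition zero_stable alpha : Prop := forall j b,
  size b = (size j).-1 -> 0 \in b -> alpha j b = 0.
Definition odd_null alpha : Prop := forall j b,
  size b = (size j).-1 -> odd (size j) -> alpha j b = 0.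

Lemma size_cut_word p q n j : size j = n -> (0 < p)%N -> (p + q <= n.+1)%N ->
  size (cut_word p q n j) = (n - q)%N.
Proof.
by move=> sz_j p0 pq; rewrite size_cat !size_slice ?sz_j; lia.
Qed.

(** A zero argument is either an argument of the removed block, or a factor of
    the argument that replaces this block, or left untouched; it never
    disappears. *)
Lemma hat_zero alpha m n (P : {set {set 'I_n}}) j b : zero_stable alpha ->
  size j = n -> size b = n.-1 -> 0 \in b -> hat alpha m P j b = 0.
Proof.
move=> a0; elim: m n P j b => // m IHm n P j b sz_j sz_b b0.
have [->|-> //|[p [q [[p0 q0 pq] [_ ->]]]]] := hat_cases m P.
  by rewrite hat_top a0 // sz_j.
have sz_w := size_cut_word sz_j p0 pq.
have sz_v : size (slice j p (p + q - 1)) = q by rewrite size_slice ?sz_j; lia.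
set t := index 0 b; have lt_t : (t < n.-1)%N by rewrite -sz_b index_mem.
have bt : nth 0 b t = 0 by rewrite nth_index.
have slice0 i k : (i.-1 <= t < k)%N -> 0 \in slice b i k.
  by move=> it; rewrite -bt mem_slice ?sz_b.
have nth0 i : t = i.-1 -> nth 0 b i.-1 = 0 by move=> <-.
rewrite /=; case: ifP => [p2|p1]; first case: ifP => [pq_n|pq_n].
- apply: IHm => //; first by rewrite size_cat /= !size_slice ?sz_b; lia.
  rewrite mem_cat inE; have [t1|t1] := ltnP t (p - 2).
    by rewrite slice0 //; lia.
  have [t2|t2] := ltnP (p + q - 2) t.
    by rewrite [X in [|| _, _ | X]]slice0 ?orbT //; lia.
  suff -> : nth 0 b (p - 1).-1 * alpha (slice j p (p + q - 1)) (slice b p (p + q - 2))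
      * nth 0 b (p + q - 1).-1 = 0 by rewrite eqxx orbT.
  have [t3|t3] := eqVneq t (p - 2)%N; first by rewrite nth0 ?mul0r //; lia.
  have [t4|t4] := eqVneq t (p + q - 2)%N; first by rewrite [nth _ _ (p + q - 1).-1]nth0 ?mulr0 //; lia.
  rewrite a0 ?mulr0 ?mul0r //; first by rewrite sz_v size_slice ?sz_b; lia.
  by apply: slice0; lia.
- have [t1|t1] := ltnP t (p - 2).
    rewrite IHm ?mul0r //; first by rewrite size_slice ?sz_b; lia.
    by apply: slice0; lia.
  have [t3|t3] := eqVneq t (p - 2)%N; first by rewrite nth0 ?mulr0 ?mul0r //; lia.
  rewrite a0 ?mulr0 //; first by rewrite sz_v size_slice ?sz_b; lia.
  by apply: slice0; lia.
have [t1|t1] := ltnP t (q - 1).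
  rewrite a0 ?mul0r //; first by rewrite sz_v size_slice ?sz_b; lia.
  by apply: slice0; lia.
have [t3|t3] := eqVneq t (q - 1)%N; first by rewrite nth0 ?mulr0 ?mul0r //; lia.
rewrite IHm ?mulr0 //; first by rewrite size_slice ?sz_b; lia.
by apply: slice0; lia.
Qed.

(** If the removed block is even, an odd number of indices remains; if it is
    odd, its value is zero and appears as a factor or in an argument. *)
Lemma hat_odd alpha m n (P : {set {set 'I_n}}) j b :
    zero_stable alpha -> odd_null alpha ->
  size j = n -> size b = n.-1 -> odd n -> hat alpha m P j b = 0.
Proof.
move=> a0 a1; elim: m n P j b => // m IHm n P j b sz_j sz_b odd_n.
have [->|-> //|[p [q [[p0 q0 pq] [_ ->]]]]] := hat_cases m P.
  by rewrite hat_top a1 // sz_j.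
have sz_w := size_cut_word sz_j p0 pq.
have sz_v : size (slice j p (p + q - 1)) = q by rewrite size_slice ?sz_j; lia.
have [odd_q|even_q] := boolP (odd q).
  rewrite /=; case: ifP => [p2|p1]; first case: ifP => [pq_n|pq_n].
  - rewrite a1 ?sz_v // ?mulr0 ?mul0r; last by rewrite size_slice ?sz_b; lia.
    apply: hat_zero => //; first by rewrite size_cat /= !size_slice ?sz_b; lia.
    by rewrite mem_cat mem_head orbT.
  - by rewrite a1 ?mulr0 ?sz_v // size_slice ?sz_b; lia.
  - by rewrite a1 ?mul0r ?sz_v // size_slice ?sz_b; lia.
have odd_nq : odd (n - q) by rewrite oddB ?odd_n //; lia.
rewrite /=; case: ifP => [p2|p1]; first case: ifP => [pq_n|pq_n].
- by apply: IHm => //; rewrite size_cat /= !size_slice ?sz_b; lia.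
- by rewrite IHm ?mul0r // size_slice ?sz_b; lia.
- by rewrite IHm ?mulr0 // size_slice ?sz_b; lia.
Qed.
End Hat.

Section CumulantVanishing.
Variables (C : numClosedFieldType) (B : starAlgType C) (A : ncpSpace B).
Variables (I : Type) (f : I -> A).

Lemma mom_zero (x : seq A) b : size b = (size x).-1 -> 0 \in b -> mom x b = 0.
Proof.
rewrite /mom => sz_b b0; suff -> : word x b = 0 by rewrite raddf0.
elim: x b sz_b b0 => [|x xs IHx] [|c b] //= sz_b.
rewrite inE => /predU1P[<-|b0]; first by rewrite raddf0 mulr0 mul0r.
by rewrite IHx ?mulr0 // -sz_b.
Qed.

Lemma cumulant_zero : zero_stable (cumulant f).
Proof.
move=> j b; rewrite /cumulant; move: (size j).+1 => m; elim: m j b => // m IHm j b sz_b b0 /=.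
rewrite mom_zero ?size_map // big1 ?subr0 // => P _.
by apply: hat_zero => // j' b'; apply: IHm.
Qed.

Lemma cumulant_odd :
    (forall j b, size b = (size j).-1 -> odd (size j) -> mom (map f j) b = 0) ->
  odd_null (cumulant f).
Proof.
move=> mom_odd j b; rewrite /cumulant; move: (size j).+1 => m.
have rec0 m' : zero_stable (cumulant_rec f m').
  elim: m' => // m' IHm j' b' sz_b b0 /=.
  rewrite mom_zero ?size_map // big1 ?subr0 // => P _.
  exact: hat_zero.
elim: m j b => // m IHm j b sz_b odd_j /=.
by rewrite mom_odd // big1 ?subr0 // => P _; apply: hat_odd.
Qed.
End CumulantVanishing.

Section Twisting.
Variables (C : numClosedFieldType) (B : starAlgType C).
Variable theta : {lrmorphism B -> B}.

(** The symmetry of the theorem in length [n], for moments as well as for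
    cumulants. *)
Definition twisted (alpha : seq bool -> seq B -> B) (n : nat) : Prop :=
  forall b, size b = n.-1 -> alpha (alt true false n) (altmap id theta b)
    = theta (alpha (alt false true n) (altmap theta id b)).

Lemma nth_altmap_odd (s : seq B) i :
  nth 0 (altmap id theta s) i = if odd i then theta (nth 0 s i) else nth 0 s i.
Proof.
have [lt_i|le_i] := ltnP i (size s).
  by rewrite (nth_altmap _ _ 0 0 lt_i); case: odd.
by rewrite !nth_default ?size_altmap //; case: odd; rewrite ?raddf0.
Qed.
Lemma nth_altmap_even (s : seq B) i :
  nth 0 (altmap theta id s) i = if odd i then nth 0 s i else theta (nth 0 s i).
Proof.
have [lt_i|le_i] := ltnP i (size s).
  by rewrite (nth_altmap _ _ 0 0 lt_i); case: odd.
by rewrite !nth_default ?size_altmap //; case: odd; rewrite ?raddf0.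
Qed.

(** Removing an even interval does not disturb the alternation. *)
Lemma cut_alt (T : Type) (x y : T) p q n : (0 < p)%N -> (p + q <= n.+1)%N -> ~~ odd q ->
  cut_word p q n (alt x y n) = alt x y (n - q).
Proof.
move=> p0 pq even_q; rewrite /cut_word !slice_alt ?addn_gt0 ?p0 //; try lia.
rewrite /= oddD (negPf even_q) addbF.
have -> : (n - q = (p - 1).+1 - 1 + (n.+1 - (p + q)))%N by lia.
by rewrite alt_cat subSS subn0 oddB // addbT; case: odd.
Qed.

(** By the symmetry for the removed block, its value is twisted in the way that
    the neighbouring arguments [b_(p-1)] and [b_(p+q-1)] are, so the product of
    the three is again an argument that follows the pattern.  The bound [N]
    leaves out the cumulant of the full length, for which the symmetry is the
    claim to be proved. *)
Lemma hat_twisted alpha N m n (P : {set {set 'I_n}}) b :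
    zero_stable alpha -> odd_null alpha ->
    (forall k, (0 < k < N)%N -> ~~ odd k -> twisted alpha k) ->
    (0 < n <= N)%N -> ~~ odd n -> (n == N -> P != [set [set: 'I_n]]) -> size b = n.-1 ->
  hat alpha m P (alt true false n) (altmap id theta b)
  = theta (hat alpha m P (alt false true n) (altmap theta id b)).
Proof.
move=> a0 a1 tw_a; elim: m n P b => [|m IHm] n P b; first by rewrite raddf0.
move=> n_N even_n top_n sz_b.
have [PE|P0|[p [q [[p0 q0 pq] [nP hatE]]]]] := @hat_cases C B bool m n P.
- rewrite PE !hat_top tw_a //.
  by move: top_n; rewrite PE eqxx; case: eqP => [_ /(_ isT)//|]; lia.
- by rewrite !P0 raddf0.
rewrite !hatE {hatE} /=.
have sz_v (x y : bool) : size (slice (alt x y n) p (p + q - 1)) = q.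
  by rewrite size_slice ?size_alt; lia.
have [odd_q|even_q] := boolP (odd q).
  have sz_cut (x y : bool) : size (cut_word p q n (alt x y n)) = (n - q)%N.
    by rewrite size_cut_word ?size_alt.
  case: ifP => [p2|p1]; first case: ifP => [pq_n|pq_n].
  - rewrite !a1 ?sz_v // ?size_slice ?size_altmap ?sz_b; try lia.
    rewrite !(mulr0, mul0r) !hat_zero ?raddf0 ?sz_cut // ?mem_cat ?mem_head ?orbT //.
      by rewrite size_cat /= !size_slice ?size_altmap ?sz_b; lia.
    by rewrite size_cat /= !size_slice ?size_altmap ?sz_b; lia.
  - by rewrite !a1 ?mulr0 ?raddf0 ?sz_v // ?size_slice ?size_altmap ?sz_b; lia.
  - by rewrite !a1 ?mul0r ?raddf0 ?sz_v // ?size_slice ?size_altmap ?sz_b; lia.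
(* If the interval is everything although the partition is not the one-block
   partition, there is no argument b_q, and the default value 0 is taken. *)
have [qn|q_lt] := eqVneq q n.
  case: ifP => [p2|_]; first by lia.
  by rewrite ![nth _ _ q.-1]nth_default ?size_altmap ?sz_b ?qn //
    !(mulr0, mul0r, raddf0).
have odd_pq : odd (p + q) = odd p by rewrite oddD (negPf even_q) addbF.
have cutE (x y : bool) : cut_word p q n (alt x y n) = alt x y (n - q) by rewrite cut_alt.
have vE (x y : bool) : slice (alt x y n) p (p + q - 1) = if odd p then alt x y q else alt y x q.
  rewrite slice_alt //; last lia.
  by rewrite (_ : ((p + q - 1).+1 - p = q)%N) //; lia.
have tw_q b' : size b' = q.-1 -> alpha (alt true false q) (altmap id theta b')
    = theta (alpha (alt false true q) (altmap theta id b')).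
  by move=> sz_b'; apply: tw_a => //; lia.
have IHq (P' : {set {set 'I_(n - q)}}) b' : size b' = (n - q).-1 ->
    hat alpha m P' (alt true false (n - q)) (altmap id theta b')
    = theta (hat alpha m P' (alt false true (n - q)) (altmap theta id b')).
  by move=> sz_b'; apply: IHm => //; [lia|rewrite oddB ?(negPf even_n) //; lia|lia].
rewrite !cutE !vE !nth_altmap_odd !nth_altmap_even.
case: ifP => [p2|p1]; first case: ifP => [pq_n|pq_n].
- set c := nth 0 b (p - 1).-1; set d := nth 0 b (p + q - 1).-1.
  have odd_c : odd (p - 1).-1 = odd p by rewrite -subn1 -subnDA oddB // addbF.
  have odd_d : odd (p + q - 1).-1 = odd p.
    by rewrite -subn1 -subnDA oddB ?odd_pq ?addbF // ltn_addr.
  rewrite odd_c odd_d !slice_altmap ?addn_gt0 ?p0 // odd_pq /=.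
  pose s := slice b p (p + q - 2).
  have sz_s : size s = q.-1 by rewrite size_slice ?sz_b; clear -pq p0 q0 q_lt sz_b n_N pq_n p2; lia.
  (* The new argument in its untwisted form; the pattern applies theta to it on
     exactly one of the two sides, depending on the parity of p. *)
  pose z := c * alpha (alt false true q) (altmap theta id s) * d.
  pose b' := slice b 1 (p - 2) ++ z :: slice b (p + q) (n - 1).
  have sz_b' : size b' = (n - q).-1.
    by rewrite size_cat /= !size_slice ?sz_b; clear -pq p0 q0 q_lt sz_b n_N pq_n p2; lia.
  have := IHq (remove_block P p q) b' sz_b'.
  rewrite !altmap_cat (_ : size (slice b 1 (p - 2)) = (p - 2)%N); last first.
    by rewrite size_slice ?sz_b; clear -pq p0 q0 q_lt sz_b n_N pq_n p2; lia.
  rewrite oddB // addbF.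
  case: (odd p) => /=; rewrite -/s /z ?tw_q // !rmorphM //.
- set c := nth 0 b (p - 1).-1; set s := slice b p (n - 1).
  have odd_p : odd p.
    rewrite -odd_pq (_ : (p + q = n.+1)%N); last by clear -p0 pq pq_n; lia.
    by rewrite oddS even_n.
  have odd_c : odd (p - 1).-1 by rewrite -subn1 -subnDA oddB // addbF.
  rewrite !slice_altmap // odd_c odd_p /= -/s IHq; last first.
    by rewrite size_slice ?sz_b; clear -pq p0 q0 q_lt sz_b n_N pq_n p2; lia.
  by rewrite tw_q ?rmorphM // size_slice ?sz_b; clear -pq p0 q0 q_lt sz_b n_N pq_n p2; lia.
have {p1 p0} p1 : p = 1%N by clear -p0 p1; lia.
rewrite p1 !slice_altmap // /= (negPf even_q) /= IHq; last first.
  by rewrite size_slice ?sz_b; clear -p1 pq q0 q_lt sz_b n_N; lia.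
have -> : odd q.-1 by rewrite -subn1 oddB // (negPf even_q).
by rewrite tw_q ?rmorphM // size_slice ?sz_b; clear -p1 pq q0 q_lt sz_b n_N; lia.
Qed.
End Twisting.
Section MomentCumulant.
Variables (C : numClosedFieldType) (B : starAlgType C) (A : ncpSpace B).
Variable theta : {lrmorphism B -> B}.

Lemma moment_cumulant_split (I : Type) (f : I -> A) j b n : size j = n -> (0 < n)%N ->
  mom (map f j) b = cumulant f j b
    + \sum_(P in NC n | P != [set [set: 'I_n]]) hat (cumulant f) n P j b.
Proof.
move=> <- j_gt0; rewrite moment_cumulant // (bigD1 [set [set: 'I_(size j)]]) ?NC_top //.
congr (_ + _); by case: (size j) j_gt0 => // n1 _; rewrite hat_top.
Qed.

Variable a : A.
Hypothesis a_odd : forall j b, size b = (size j).-1 -> odd (size j) ->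
  mom (map (spow a) j) b = 0.
Local Notation moms := (fun j b => mom (map (spow a) j) b).
Local Notation cums := (cumulant (spow a)).

(** The difference of a moment and the cumulant of the same length only
    involves shorter cumulants. *)
Lemma twisted_moment_cumulant n : (0 < n)%N -> ~~ odd n ->
    (forall k, (0 < k < n)%N -> ~~ odd k -> twisted theta cums k) ->
  twisted theta moms n <-> twisted theta cums n.
Proof.
move=> n_gt0 even_n IH.
have sumE b : size b = n.-1 ->
    \sum_(P in NC n | P != [set [set: 'I_n]])
      hat cums n P (alt true false n) (altmap id theta b)
    = theta (\sum_(P in NC n | P != [set [set: 'I_n]])
      hat cums n P (alt false true n) (altmap theta id b)).
  move=> sz_b; rewrite raddf_sum; apply: eq_bigr => P /andP[_ nP].
  apply: (@hat_twisted _ _ _ _ n) => //; rewrite ?n_gt0 ?leqnn //.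
    exact: cumulant_zero.
  exact: cumulant_odd.
have splitE e b : mom (map (spow a) (alt e (~~ e) n)) b = cums (alt e (~~ e) n) b
    + \sum_(P in NC n | P != [set [set: 'I_n]]) hat cums n P (alt e (~~ e) n) b.
  by apply: moment_cumulant_split => //; apply: size_alt.
split=> tw b sz_b; have := tw b sz_b; rewrite (splitE true) (splitE false) sumE //.
  by rewrite raddfD /= => /addIr.
by move=> ->; rewrite [RHS]rmorphD.
Qed.

Theorem twisted_moments_cumulants :
  (forall n, (0 < n)%N -> ~~ odd n -> twisted theta moms n)
  <-> (forall n, (0 < n)%N -> ~~ odd n -> twisted theta cums n).
Proof.
split=> tw n n_gt0 even_n.
  have [N] := ubnP n; elim: N n n_gt0 even_n => // N IHN n n_gt0 even_n; rewrite ltnS => le_nN.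
  apply/(twisted_moment_cumulant n_gt0 even_n); last exact: tw.
  move=> k /andP[k_gt0 lt_kn] even_k; apply: IHN => //; exact: leq_trans lt_kn le_nN.
apply/(twisted_moment_cumulant n_gt0 even_n); last exact: tw.
by move=> k /andP[k_gt0 _] even_k; apply: tw.
Qed.
End MomentCumulant.

(** * The free product with a Haar unitary *)

(** An operator together with a candidate for its adjoint.  The involution
    exchanges the two, so no inner product is needed.  The forward components
    act from the right: the first factor of a product is applied first.  The
    module is nonzero so that these pairs form a nontrivial ring. *)
Record opair (C : numClosedFieldType) (B : starAlgType C) (M : lmodType B)
    (M_nz : exists v : M, v != 0) := Opair {
  fwd : M -> M;
  bwd : M -> M;
  fwd_linear : linear fwd;
  bwd_linear : linear bwd
}.

Section OperatorPairs.
Variables (C : numClosedFieldType) (B : starAlgType C) (M : lmodType B).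
Variable M_nz : exists v : M, v != 0.
Local Notation opair := (opair M_nz).
Implicit Types x y z : opair.

Lemma opair_eq x y : fwd x =1 fwd y -> bwd x =1 bwd y -> x = y.
Proof.
case: x y => f g lf lg [f' g' lf' lg'] /= /funext eq_f /funext eq_g.
move: lf lg lf' lg'; rewrite eq_f eq_g => lf lg lf' lg'.
by congr Opair; apply: Prop_irrelevance.
Qed.

HB.instance Definition _ := gen_eqMixin opair.
HB.instance Definition _ := gen_choiceMixin opair.

Lemma fwdD x : {morph fwd x : f g / f + g}.
Proof. by move=> f g; have := fwd_linear x 1 f g; rewrite !scale1r. Qed.
Lemma bwdD x : {morph bwd x : f g / f + g}.
Proof. by move=> f g; have := bwd_linear x 1 f g; rewrite !scale1r. Qed.
Lemma fwd0 x : fwd x 0 = 0.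
Proof. by apply: (addrI (fwd x 0)); rewrite -fwdD !addr0. Qed.
Lemma bwd0 x : bwd x 0 = 0.
Proof. by apply: (addrI (bwd x 0)); rewrite -bwdD !addr0. Qed.
Lemma fwdZ x b f : fwd x (b *: f) = b *: fwd x f.
Proof. by have := fwd_linear x b f 0; rewrite fwd0 !addr0. Qed.
Lemma bwdZ x b f : bwd x (b *: f) = b *: bwd x f.
Proof. by have := bwd_linear x b f 0; rewrite bwd0 !addr0. Qed.

Program Definition opair0 : opair :=
  @Opair _ _ _ _ (fun=> 0) (fun=> 0) _ _.
Next Obligation. by move=> b f g; rewrite scaler0 addr0. Qed.
Next Obligation. by move=> b f g; rewrite scaler0 addr0. Qed.

Program Definition opairN x : opair :=
  @Opair _ _ _ _ (fun f => - fwd x f) (fun f => - bwd x f) _ _.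
Next Obligation. by move=> b f g; rewrite fwdD fwdZ opprD scalerN. Qed.
Next Obligation. by move=> b f g; rewrite bwdD bwdZ opprD scalerN. Qed.

Program Definition opairD x y : opair :=
  @Opair _ _ _ _ (fun f => fwd x f + fwd y f) (fun f => bwd x f + bwd y f) _ _.
Next Obligation. by move=> b f g; rewrite !fwdD !fwdZ scalerDr addrACA. Qed.
Next Obligation. by move=> b f g; rewrite !bwdD !bwdZ scalerDr addrACA. Qed.

Program Definition opair1 : opair := @Opair _ _ _ _ id id _ _.
Next Obligation. by []. Qed.
Next Obligation. by []. Qed.

Program Definition opairM x y : opair :=
  @Opair _ _ _ _ (fwd y \o fwd x) (bwd x \o bwd y) _ _.
Next Obligation. by move=> b f g /=; rewrite !fwdD !fwdZ. Qed.
Next Obligation. by move=> b f g /=; rewrite !bwdD !bwdZ. Qed.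

Program Definition opair_star x : opair := @Opair _ _ _ _ (bwd x) (fwd x) _ _.
Next Obligation. exact: bwd_linear. Qed.
Next Obligation. exact: fwd_linear. Qed.

Lemma scale_algC (c : C) (b : B) : c%:A * b = b * c%:A.
Proof. by rewrite mulr_algl mulr_algr. Qed.

(** Scalars of [C] act through the center of [B], hence [B]-linearly. *)
Program Definition opairZ (c : C) x : opair :=
  @Opair _ _ _ _ (fun f => (c%:A : B) *: fwd x f)
    (fun f => ((c^* )%:A : B) *: bwd x f) _ _.
Next Obligation.
by move=> b f g; rewrite fwdD fwdZ scalerDr !scalerA scale_algC.
Qed.
Next Obligation.
by move=> b f g; rewrite bwdD bwdZ scalerDr !scalerA scale_algC.
Qed.

Fact opair_addA : associative opairD.
Proof. by move=> x y z; apply: opair_eq => f /=; rewrite addrA. Qed.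
Fact opair_addC : commutative opairD.
Proof. by move=> x y; apply: opair_eq => f /=; rewrite addrC. Qed.
Fact opair_add0 : left_id opair0 opairD.
Proof. by move=> x; apply: opair_eq => f /=; rewrite add0r. Qed.
Fact opair_addN : left_inverse opair0 opairN opairD.
Proof. by move=> x; apply: opair_eq => f /=; rewrite addNr. Qed.
HB.instance Definition _ :=
  GRing.isZmodule.Build opair opair_addA opair_addC opair_add0 opair_addN.

Fact opair_mulA : associative opairM.
Proof. by move=> x y z; apply: opair_eq. Qed.
Fact opair_mul1 : left_id opair1 opairM.
Proof. by move=> x; apply: opair_eq. Qed.
Fact opair_mulr1 : right_id opair1 opairM.
Proof. by move=> x; apply: opair_eq. Qed.
Fact opair_mulDl : left_distributive opairM opairD.
Proof. by move=> x y z; apply: opair_eq => f /=; rewrite ?fwdD. Qed.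
Fact opair_mulDr : right_distributive opairM opairD.
Proof. by move=> x y z; apply: opair_eq => f /=; rewrite ?bwdD. Qed.
Fact opair_1neq0 : opair1 != opair0.
Proof.
apply/eqP => e10; have [v /eqP[]] := M_nz.
by have := congr1 (fun x => fwd x v) e10.
Qed.
HB.instance Definition _ := GRing.Zmodule_isNzRing.Build opair
  opair_mulA opair_mul1 opair_mulr1 opair_mulDl opair_mulDr opair_1neq0.

Fact opair_scaleA (c d : C) x : opairZ c (opairZ d x) = opairZ (c * d) x.
Proof.
by apply: opair_eq => f /=; rewrite scalerA mulr_algl scalerA // rmorphM.
Qed.
Fact opair_scale1 : left_id 1 opairZ.
Proof.
by move=> x; apply: opair_eq => f /=; rewrite ?conjC1 !scale1r.
Qed.
Fact opair_scaleDr : right_distributive opairZ +%R.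
Proof. by move=> c x y; apply: opair_eq => f /=; rewrite scalerDr. Qed.
Fact opair_scaleDl x : {morph opairZ^~ x : c d / c + d}.
Proof.
by move=> c d; apply: opair_eq => f /=; rewrite ?rmorphD -scalerDl -scalerDl.
Qed.
HB.instance Definition _ := GRing.Zmodule_isLmodule.Build C opair
  opair_scaleA opair_scale1 opair_scaleDr opair_scaleDl.

Fact opair_scaleAl (c : C) x y : c *: (x * y) = c *: x * y.
Proof. by apply: opair_eq => f /=; rewrite ?fwdZ ?bwdZ. Qed.
HB.instance Definition _ := GRing.Lmodule_isLalgebra.Build C opair opair_scaleAl.
Fact opair_scaleAr (c : C) x y : c *: (x * y) = x * (c *: y).
Proof. by apply: opair_eq => f /=; rewrite ?fwdZ ?bwdZ. Qed.
HB.instance Definition _ := GRing.Lalgebra_isAlgebra.Build C opair opair_scaleAr.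

Fact opair_starK : involutive opair_star.
Proof. by move=> x; apply: opair_eq. Qed.
Fact opair_starD : {morph opair_star : x y / x + y}.
Proof. by move=> x y; apply: opair_eq. Qed.
Fact opair_starM x y : opair_star (x * y) = opair_star y * opair_star x.
Proof. by apply: opair_eq. Qed.
Fact opair_starZ (c : C) x : opair_star (c *: x) = c^* *: opair_star x.
Proof. by apply: opair_eq => f /=; rewrite ?conjCK. Qed.
HB.instance Definition _ := Algebra_isStarAlgebra.Build C opair
  opair_starK opair_starD opair_starM opair_starZ.

Lemma fwd_add x y f : fwd (x + y) f = fwd x f + fwd y f. Proof. by []. Qed.
Lemma bwd_add x y f : bwd (x + y) f = bwd x f + bwd y f. Proof. by []. Qed.
Lemma fwd_scale (c : C) x f : fwd (c *: x) f = (c%:A : B) *: fwd x f.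
Proof. by []. Qed.
Lemma bwd_scale (c : C) x f : bwd (c *: x) f = ((c^* )%:A : B) *: bwd x f.
Proof. by []. Qed.
Lemma fwd_mul x y f : fwd (x * y) f = fwd y (fwd x f). Proof. by []. Qed.
Lemma bwd_mul x y f : bwd (x * y) f = bwd x (bwd y f). Proof. by []. Qed.

End OperatorPairs.

Section TwistPowers.
Variables (B : pzRingType) (theta : {rmorphism B -> B}) (thetaV : B -> B).
Hypotheses (thetaK : cancel theta thetaV) (thetaVK : cancel thetaV theta).

Lemma thetaVM : {morph thetaV : x y / x * y}.
Proof. by move=> x y; apply: (can_inj thetaK); rewrite rmorphM !thetaVK. Qed.
Lemma thetaVD : {morph thetaV : x y / x + y}.
Proof. by move=> x y; apply: (can_inj thetaK); rewrite rmorphD !thetaVK. Qed.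
Lemma thetaV1 : thetaV 1 = 1.
Proof. by apply: (can_inj thetaK); rewrite thetaVK rmorph1. Qed.

End TwistPowers.

Definition twist (T : Type) (theta thetaV : T -> T) (k : int) : T -> T :=
  match k with Posz n => iter n theta | Negz n => iter n.+1 thetaV end.

Section TwistTheory.
Variables (C : numClosedFieldType) (B : starAlgType C).
Variables (theta : {lrmorphism B -> B}) (thetaV : B -> B).
Hypotheses (thetaK : cancel theta thetaV) (thetaVK : cancel thetaV theta).
Hypothesis theta_star : forall b, theta (star b) = star (theta b).
Local Notation tw := (twist theta thetaV).

Lemma twistM k : {morph tw k : x y / x * y}.
Proof.
case: k => n x y; first by elim: n => //= n ->; rewrite rmorphM.
by rewrite /tw; elim: n.+1 => //= m ->; rewrite (thetaVM thetaK thetaVK).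
Qed.
Lemma twistD k : {morph tw k : x y / x + y}.
Proof.
case: k => n x y; first by elim: n => //= n ->; rewrite rmorphD.
by rewrite /tw; elim: n.+1 => //= m ->; rewrite (thetaVD thetaK thetaVK).
Qed.
Lemma twist1 k : tw k 1 = 1.
Proof.
case: k => n; first by elim: n => //= n ->; rewrite rmorph1.
by rewrite /tw; elim: n.+1 => //= m ->; rewrite (thetaV1 thetaK thetaVK).
Qed.
Lemma twistZ k c b : tw k (c *: b) = c *: tw k b.
Proof.
have thetaVZ x : thetaV (c *: x) = c *: thetaV x.
  by apply: (can_inj thetaK); rewrite linearZ /= !thetaVK.
case: k => n; first by elim: n => //= n ->; rewrite linearZ.
by rewrite /tw; elim: n.+1 => //= m ->; rewrite thetaVZ.
Qed.
Lemma twist_star k b : tw k (star b) = star (tw k b).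
Proof.
have thetaV_star x : thetaV (star x) = star (thetaV x).
  by apply: (can_inj thetaK); rewrite thetaVK theta_star thetaVK.
case: k => n; first by elim: n => //= n ->; rewrite theta_star.
by rewrite /tw; elim: n.+1 => //= m ->; rewrite thetaV_star.
Qed.
Lemma twistS k b : tw (1 + k) b = theta (tw k b).
Proof.
case: k => [n|n]; first by rewrite -intS.
have -> : 1 + Negz n = - n%:Z by rewrite NegzE intS opprD addrA subrr add0r.
by case: n => [|n]; rewrite ?oppr0 -?NegzE /= thetaVK.
Qed.
Lemma twistP k b : tw (-1 + k) b = thetaV (tw k b).
Proof. by rewrite -[in RHS](addKr (-1) k) opprK twistS thetaK. Qed.
Lemma twist_add k l b : tw (k + l) b = tw k (tw l b).
Proof.
case: k => n.
  elim: n => [|n IHn]; first by rewrite add0r.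
  by rewrite intS -addrA !twistS IHn.
elim: n => [|n IHn]; first by rewrite twistP.
have -> : Negz n.+1 = -1 + Negz n by rewrite !NegzE (intS n.+1) opprD.
by rewrite -addrA !twistP IHn.
Qed.
End TwistTheory.

Section TestFunctions.
Variables (C : numClosedFieldType) (B : starAlgType C) (P : ncpSpace B).
Variables (theta thetaV : B -> B).
Local Notation inP := (ncp_in P).
Local Notation tw := (twist theta thetaV).

(** [([:: (n1, x1); (n2, x2)], (m, b))] stands for the word
    [u^n1 x1 u^n2 x2 u^m b] applied to the vacuum. *)
Definition vec : Type := (seq (int * P) * (int * B))%type.

Definition cons_vec (z : int * P) (v : vec) : vec := (z :: v.1, v.2).
Definition cat_vec (l : seq (int * P)) (v : vec) : vec := (l ++ v.1, v.2).

(** The scalar is moved to the right through the leading power of [u]. *)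
Definition lmul_vec (b : B) (v : vec) : vec :=
  match v with
  | ([::], (m, b')) => ([::], (m, tw m b * b'))
  | ((n, x) :: l, t) => ((n, inP (tw n b) * x) :: l, t)
  end.

Definition shift_vec (k : int) (v : vec) : vec :=
  match v with
  | ([::], (m, b)) => ([::], (k + m, b))
  | ((n, x) :: l, t) => ((k + n, x) :: l, t)
  end.

(** Functionals on the free product module.  They are functions of words that
    are multilinear, right [B]-linear and balanced over [B]; using them in place
    of the module makes tensor products over [B] unnecessary.  The balance
    condition is imposed at every depth [l], since the operators below reach
    into the words. *)
Definition test (f : vec -> B) : Prop :=
  [/\ forall l n c x y v, f (cat_vec l (cons_vec (n, c *: x + y) v))
        = c *: f (cat_vec l (cons_vec (n, x) v)) + f (cat_vec l (cons_vec (n, y) v)),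
      forall l m b b', f (l, (m, b * b')) = f (l, (m, b)) * b'
    & forall l n x b v, f (cat_vec l (cons_vec (n, x * inP b) v))
        = f (cat_vec l (cons_vec (n, x) (lmul_vec b v)))].

Definition testb : {pred (vec -> B^o)} := fun f => `[< test f >].

Fact test_submod : submod_closed testb.
Proof.
split; first by apply/asboolP; split=> *; rewrite /= ?scaler0 ?addr0 ?mul0r.
move=> a f g /asboolP[fL fR fB] /asboolP[gL gR gB]; apply/asboolP.
have sE v : (a *: f + g) v = a * f v + g v by [].
split=> [l n c x y v|l m b b'|l n x b v]; rewrite !sE.
- by rewrite fL gL mulrDr -scalerAr scalerDr addrACA.
- by rewrite fR gR mulrDl mulrA.
- by rewrite fB gB.
Qed.
HB.instance Definition _ :=
  GRing.isSubmodClosed.Build B (vec -> B^o) testb test_submod.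

Record testFun := TestFun { test_fun :> vec -> B^o; _ : test_fun \in testb }.
HB.instance Definition _ := [isSub for test_fun].
HB.instance Definition _ := [Choice of testFun by <:].
HB.instance Definition _ := [SubChoice_isSubLmodule of testFun by <:].

Lemma testP (f : testFun) : test f.
Proof. by case: f => f tf; apply/asboolP. Qed.

Lemma testFunD (f g : testFun) v : (f + g) v = f v + g v.
Proof. by []. Qed.
Lemma testFunZ b (f : testFun) v : (b *: f) v = b * f v.
Proof. by []. Qed.
End TestFunctions.

Section Model.
Variables (C : numClosedFieldType) (B : starAlgType C) (P : ncpSpace B).
Variables (theta : {lrmorphism B -> B}) (thetaV : B -> B).
Hypotheses (thetaK : cancel theta thetaV) (thetaVK : cancel thetaV theta).
Hypothesis theta_star : forall b, theta (star b) = star (theta b).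
Local Notation inP := (ncp_in P).
Local Notation phi := (ncp_E P).
Local Notation tw := (twist theta thetaV).
Local Notation vec := (vec P).
Local Notation bact := (@lmul_vec C B P theta thetaV).
Local Notation uact := (@shift_vec C B P).
Local Notation test := (@test C B P theta thetaV).
Local Notation testFun := (@testFun C B P theta thetaV).
Implicit Types (f g : testFun) (v : vec) (b : B) (l : seq (int * P)).

Definition mk_test (f : vec -> B) (tf : test f) : testFun :=
  @TestFun C B P theta thetaV f (asboolT tf).

Lemma test_eq f g : f =1 g -> f = g.
Proof. by move=> /funext eq_fg; apply: val_inj. Qed.

Lemma testL f l n c x y v : f (cat_vec l (cons_vec (n, c *: x + y) v))
  = c *: f (cat_vec l (cons_vec (n, x) v)) + f (cat_vec l (cons_vec (n, y) v)).
Proof. by have [+ _ _] := testP f; apply. Qed.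
Lemma testR f l m b b' : f (l, (m, b * b')) = f (l, (m, b)) * b'.
Proof. by have [_ + _] := testP f; apply. Qed.
Lemma testB f l n x b v : f (cat_vec l (cons_vec (n, x * inP b) v))
  = f (cat_vec l (cons_vec (n, x) (bact b v))).
Proof. by have [_ _ +] := testP f; apply. Qed.
Lemma cat0_vec v : cat_vec [::] v = v. Proof. by case: v. Qed.
Lemma testL0 f n c x y v : f (cons_vec (n, c *: x + y) v)
  = c *: f (cons_vec (n, x) v) + f (cons_vec (n, y) v).
Proof. by have := testL f [::] n c x y v; rewrite !cat0_vec. Qed.
Lemma testD0 f n x y v :
  f (cons_vec (n, x + y) v) = f (cons_vec (n, x) v) + f (cons_vec (n, y) v).
Proof. by rewrite -[x in LHS]scale1r testL0 scale1r. Qed.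
Lemma test00 f n v : f (cons_vec (n, 0) v) = 0.
Proof. by apply: (addrI (f (cons_vec (n, 0) v))); rewrite -testD0 !addr0. Qed.
Lemma testB0 f n x b v : f (cons_vec (n, x * inP b) v)
  = f (cons_vec (n, x) (bact b v)).
Proof. by have := testB f [::] n x b v; rewrite !cat0_vec. Qed.

Lemma bactM b b' v : bact (b * b') v = bact b (bact b' v).
Proof.
case: v => [[|[n x] l] [m c]] /=; rewrite (twistM thetaK thetaVK) ?rmorphM;
  by rewrite mulrA.
Qed.
Lemma bact1 v : bact 1 v = v.
Proof.
by case: v => [[|[n x] l] [m c]] /=; rewrite (twist1 thetaK thetaVK) ?rmorph1 mul1r.
Qed.
Lemma uact0 v : uact 0 v = v.
Proof. by case: v => [[|[n x] l] [m c]] /=; rewrite add0r. Qed.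
Lemma uactD k k' v : uact (k + k') v = uact k (uact k' v).
Proof. by case: v => [[|[n x] l] [m c]] /=; rewrite addrA. Qed.
Lemma bact_uact k b v : bact b (uact k v) = uact k (bact (tw k b) v).
Proof.
by case: v => [[|[n x] l] [m c]] /=; rewrite addrC (twist_add thetaK thetaVK).
Qed.

Lemma consE z l t : cons_vec z (l, t) = (z :: l, t) :> vec. Proof. by []. Qed.

Lemma test_bactD f b b' v : f (bact (b + b') v) = f (bact b v) + f (bact b' v).
Proof.
case: v => [[|[n x] l] [m c]] /=; rewrite (twistD thetaK thetaVK).
  have fE y : f ([::], (m, y)) = f ([::], (m, 1)) * y by rewrite -testR mul1r.
  by rewrite mulrDl fE mulrDr -!fE.
by rewrite raddfD mulrDl -!consE testD0.
Qed.
Lemma test_bactZ f c b v : f (bact (c *: b) v) = c *: f (bact b v).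
Proof.
case: v => [[|[n x] l] [m y]] /=; rewrite (twistZ thetaK thetaVK).
  have fE z : f ([::], (m, z)) = f ([::], (m, 1)) * z by rewrite -testR mul1r.
  by rewrite -scalerAl fE -scalerAr -fE.
rewrite linearZ /= -scalerAl -!consE -[_ *: _]addr0 testL0 test00 addr0 //.
Qed.
Lemma test_bact0 f v : f (bact 0 v) = 0.
Proof. by apply: (addrI (f (bact 0 v))); rewrite -test_bactD !addr0. Qed.

(** A map on words that changes only the leading letter, in a way that respects
    sums and right multiplication by scalars, acts on the functionals. *)
Lemma test_op (h : vec -> vec) :
    (forall n, exists n' (g : P -> P), [/\ forall c x y, g (c *: x + y) = c *: g x + g y,
        forall x b, g (x * inP b) = g x * inP b
      & forall x l t, h ((n, x) :: l, t) = ((n', g x) :: l, t)]) ->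
    (forall m, exists m' b0, forall b, h ([::], (m, b)) = ([::], (m', b0 * b))) ->
  forall f, test (f \o h).
Proof.
move=> hc h0 f; split=> [l n c x y v|l m b b'|l n x b v] /=.
- case: l => [|[n' z] l]; rewrite /cat_vec /cons_vec /=.
    have [n' [g [gL _ gE]]] := hc n; rewrite !gE gL.
    by have := testL0 f n' c (g x) (g y) v.
  have [n'' [g [_ _ gE]]] := hc n'; rewrite !gE.
  exact: (testL f ((n'', g z) :: l)).
- case: l => [|[n x] l].
    by have [m' [b0 E0]] := h0 m; rewrite !E0 mulrA testR.
  by have [n' [g [_ _ gE]]] := hc n; rewrite !gE testR.
- case: l => [|[n' z] l]; rewrite /cat_vec /cons_vec /=.
    have [n' [g [_ gB gE]]] := hc n; rewrite !gE gB.
    by have := testB0 f n' (g x) b v.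
  have [n'' [g [_ _ gE]]] := hc n'; rewrite !gE.
  exact: (testB f ((n'', g z) :: l)).
Qed.

Fact test_bact b f : test (f \o bact b).
Proof.
apply: test_op => [n|m]; last first.
  by exists m, (tw m b) => b' /=.
exists n, (fun x => inP (tw n b) * x); split=> //= [c x y|x b'].
  by rewrite mulrDr scalerAr.
by rewrite mulrA.
Qed.
Fact test_uact k f : test (f \o uact k).
Proof.
apply: test_op => [n|m]; last by exists (k + m), 1 => b' /=; rewrite mul1r.
by exists (k + n), id.
Qed.
Fact test_cons z f : test (fun v => f (cons_vec z v)).
Proof.
split=> [l n c x y v|l m b b'|l n x b v]; rewrite /cons_vec /=.
- exact: (testL f (z :: l)).
- by rewrite testR.
- exact: (testB f (z :: l)).
Qed.

Definition opB b f := mk_test (test_bact b f).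
Definition opU k f := mk_test (test_uact k f).
Definition opC z f := mk_test (test_cons z f).

#[local] Arguments lmul_vec : simpl never.

(** The right action of [x] on functionals, dual to left multiplication of a
    word by [x].  A leading letter at level zero is multiplied by [x], otherwise
    [x] is a new leading letter; either way the leading letter is then split
    into its centered part and its expectation, which becomes a scalar acting on
    the rest of the word. *)
Definition letter (x : P) (f : vec -> B) (v : vec) : B :=
  match v with
  | ((0, y) :: l, t) => f ((0, center (x * y)) :: l, t) + f (bact (phi (x * y)) (l, t))
  | _ => f (cons_vec (0, center x) v) + f (bact (phi x) v)
  end.

Fact test_letter x f : test (letter x f).
Proof.
split=> [l n c y z v|l m b b'|l n y b v].
- case: l => [|[[[|n']|n'] w] l].
  + rewrite !cat0_vec; case: n => [[|n]|n] /=.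
    * rewrite mulrDr -scalerAr raddfD /= centerD centerZ [phi (_ *: _)]linearZ /=.
      by rewrite (testL0 f) test_bactD test_bactZ scalerDr addrACA.
    * have := testL (opC (0, center x) f) [::] n.+1 c y z v.
      have := testL (opB (phi x) f) [::] n.+1 c y z v.
      by rewrite /= => -> ->; rewrite scalerDr addrACA.
    * have := testL (opC (0, center x) f) [::] (Negz n) c y z v.
      have := testL (opB (phi x) f) [::] (Negz n) c y z v.
      by rewrite /= => -> ->; rewrite scalerDr addrACA.
  + have := testL (opC (0, center (x * w)) f) l n c y z v.
    have := testL (opB (phi (x * w)) f) l n c y z v.
    by rewrite /= => -> ->; rewrite scalerDr addrACA.
  + have := testL (opC (0, center x) f) ((n'.+1 : int, w) :: l) n c y z v.
    have := testL (opB (phi x) f) ((n'.+1 : int, w) :: l) n c y z v.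
    by rewrite /= => -> ->; rewrite scalerDr addrACA.
  + have := testL (opC (0, center x) f) ((Negz n', w) :: l) n c y z v.
    have := testL (opB (phi x) f) ((Negz n', w) :: l) n c y z v.
    by rewrite /= => -> ->; rewrite scalerDr addrACA.
- case: l => [|[[[|n']|n'] w] l] /=.
  + have := testR (opB (phi x) f) [::] m b b'.
    have := testR (opC (0, center x) f) [::] m b b'.
    by rewrite /= => -> ->; rewrite mulrDl.
  + have := testR (opB (phi (x * w)) f) l m b b'.
    have := testR (opC (0, center (x * w)) f) l m b b'.
    by rewrite /= => -> ->; rewrite mulrDl.
  + have := testR (opB (phi x) f) ((n'.+1 : int, w) :: l) m b b'.
    have := testR (opC (0, center x) f) ((n'.+1 : int, w) :: l) m b b'.
    by rewrite /= => -> ->; rewrite mulrDl.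
  + have := testR (opB (phi x) f) ((Negz n', w) :: l) m b b'.
    have := testR (opC (0, center x) f) ((Negz n', w) :: l) m b b'.
    by rewrite /= => -> ->; rewrite mulrDl.
- case: l => [|[[[|n']|n'] w] l].
  + rewrite !cat0_vec; case: n => [[|n]|n] /=.
    * rewrite mulrA centerMr ncp_EMr -!surjective_pairing bactM; congr (_ + _).
      exact: testB0.
    * have := testB (opC (0, center x) f) [::] n.+1 y b v.
      by have := testB (opB (phi x) f) [::] n.+1 y b v; rewrite /= => -> ->.
    * have := testB (opC (0, center x) f) [::] (Negz n) y b v.
      by have := testB (opB (phi x) f) [::] (Negz n) y b v; rewrite /= => -> ->.
  + have := testB (opC (0, center (x * w)) f) l n y b v.
    by have := testB (opB (phi (x * w)) f) l n y b v; rewrite /= => -> ->.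
  + have := testB (opC (0, center x) f) ((n'.+1 : int, w) :: l) n y b v.
    have := testB (opB (phi x) f) ((n'.+1 : int, w) :: l) n y b v.
    by rewrite /= => -> ->.
  + have := testB (opC (0, center x) f) ((Negz n', w) :: l) n y b v.
    have := testB (opB (phi x) f) ((Negz n', w) :: l) n y b v.
    by rewrite /= => -> ->.
Qed.

Definition opP x f := mk_test (test_letter x f).

Lemma opB_linear b : linear (opB b).
Proof. by move=> a f g; apply: test_eq. Qed.
Lemma opU_linear k : linear (opU k).
Proof. by move=> a f g; apply: test_eq. Qed.
Lemma opP_linear x : linear (opP x).
Proof.
move=> a f g; apply: test_eq => v.
suff: letter x (fun w => a * f w + g w) v
    = a * letter x f v + letter x g v by [].
by case: v => [[|[[[|n]|n] w] l] t]; rewrite /letter mulrDr addrACA.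
Qed.

Fact test_vac : test (fun v => if v is ([::], (0, b)) then b else 0).
Proof.
split=> [l n c x y v|l m b b'|l n x b v].
- by case: l => [|[? ?] l] /=; rewrite scaler0 addr0.
- by case: l => [|[? ?] l] /=; [case: m => [[|m]|m] |]; rewrite ?mul0r.
- by case: l => [|[? ?] l] /=.
Qed.
(** The coefficient of the vacuum. *)
Definition vac := mk_test test_vac.

End Model.

Section FreeProduct.
Variables (C : numClosedFieldType) (B : starAlgType C) (P : ncpSpace B).
Variables (theta : {lrmorphism B -> B}) (thetaV : B -> B).
Hypotheses (thetaK : cancel theta thetaV) (thetaVK : cancel thetaV theta).
Hypothesis theta_star : forall b, theta (star b) = star (theta b).
Local Notation inP := (ncp_in P).
Local Notation phi := (ncp_E P).
Local Notation tw := (twist theta thetaV).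
Local Notation vec := (vec P).
Local Notation bact := (@lmul_vec C B P theta thetaV).
Local Notation uact := (@shift_vec C B P).
Local Notation testFun := (@testFun C B P theta thetaV).
Local Notation opB := (@opB C B P theta thetaV).
Local Notation opU := (@opU C B P theta thetaV).
Local Notation opP := (opP (P := P) thetaK thetaVK).
Local Notation vac := (@vac C B P theta thetaV).
Implicit Types (f g : testFun) (v : vec) (b : B) (l : seq (int * P)).

#[local] Arguments lmul_vec : simpl never.
#[local] Arguments shift_vec : simpl never.

(** The vacuum vector. *)
Definition xi : vec := ([::], (0, 1)).

Fact testFun_nz : exists f : testFun, f != 0.
Proof.
exists vac; apply/eqP => /(congr1 (fun f : testFun => f xi)) /eqP.
by rewrite [X in X == _](_ : _ = 1) // [X in _ == X](_ : _ = 0) // oner_eq0.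
Qed.

Definition model : starAlgType C := opair testFun_nz.
Implicit Types x y : model.

Definition model_in b : model :=
  Opair testFun_nz (@opB_linear C B P theta thetaV b) (@opB_linear C B P theta thetaV (star b)).

Fact model_in_additive : zmod_morphism model_in.
Proof.
have opBB b b' f : opB (b - b') f = opB b f - opB b' f.
  apply: test_eq => v; rewrite -[- b']scaleN1r.
  rewrite [LHS](test_bactD thetaK thetaVK) (test_bactZ thetaK thetaVK).
  by rewrite scaleN1r.
move=> b b'; apply: opair_eq => f; first exact: opBB.
by rewrite /= starD starN; apply: opBB.
Qed.
HB.instance Definition _ := GRing.isZmodMorphism.Build B model model_in model_in_additive.
Fact model_in_multiplicative : monoid_morphism model_in.
Proof.
split; first by apply: opair_eq => f; apply: test_eq => v /=;
  rewrite ?star1 (bact1 thetaK thetaVK).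
move=> b b'; apply: opair_eq => f; apply: test_eq => v /=.
  by rewrite (bactM thetaK thetaVK).
by rewrite starM (bactM thetaK thetaVK).
Qed.
HB.instance Definition _ := GRing.isMonoidMorphism.Build B model model_in model_in_multiplicative.
Fact model_in_scalable : scalable model_in.
Proof.
move=> c b; apply: opair_eq => f; apply: test_eq => v.
  rewrite [LHS](test_bactZ thetaK thetaVK) -[in LHS](mul1r (f _)) scalerAl.
  by [].
rewrite [LHS]/= starZ (test_bactZ thetaK thetaVK) -[in LHS](mul1r (f _)) scalerAl.
by [].
Qed.
HB.instance Definition _ := GRing.isScalable.Build C B model *:%R model_in model_in_scalable.

(** Averaging over the two components makes the map compatible with the
    involution by construction, and it remains a conditional expectation.  On
    the algebras generated by [u] and by [p] the two terms turn out to be equal. *)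
Definition model_E x : B :=
  2^-1 *: (fwd x vac xi + star (bwd x vac xi)).

Fact model_E_linear : linear model_E.
Proof.
move=> c x y; rewrite /model_E.
rewrite fwd_add bwd_add fwd_scale bwd_scale !testFunD !testFunZ !mulr_algl.
move: (fwd x vac xi) (fwd y vac xi) (bwd x vac xi) (bwd y vac xi).
clear=> p q r s; rewrite starD starZ conjCK; move: (star r) (star s) => r' s'.
have half (p1 q1 r1 s1 : B) : 2^-1 *: (c *: p1 + q1 + (c *: r1 + s1))
    = c *: (2^-1 *: (p1 + r1)) + 2^-1 *: (q1 + s1).
  by rewrite addrACA -[c *: p1 + _]scalerDr [LHS]scalerDr !scalerA [c / 2]mulrC.
exact: half.
Qed.
HB.instance Definition _ := GRing.isLinear.Build C model B *:%R model_E model_E_linear.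

Fact model_in_star b : model_in (star b) = star (model_in b).
Proof. by apply: opair_eq => f //=; rewrite starK. Qed.
Fact model_E_star x : model_E (star x) = star (model_E x).
Proof.
rewrite /model_E -[LHS]/(2^-1 *: (bwd x vac xi + star (fwd x vac xi))).
move: (fwd x vac xi) (bwd x vac xi) => p q.
rewrite starZ starD starK (_ : (2^-1)^* = 2^-1 :> C) ?fmorphV ?rmorph_nat //.
by congr (_ *: _); apply: addrC.
Qed.

Lemma half_double b : 2^-1 *: (b + b) = b.
Proof.
by rewrite -mulr2n -scaler_nat scalerA mulVf ?scale1r // pnatr_eq0.
Qed.

Fact model_E_in b : model_E (model_in b) = b.
Proof.
have vac_bact b' : vac (bact b' xi) = b' by rewrite /= mulr1.
rewrite /model_E -[LHS]/(2^-1 *: (vac (bact b xi) + star (vac (bact (star b) xi)))).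
by rewrite !vac_bact starK half_double.
Qed.

Lemma test_xi f b : f (bact b xi) = f xi * b.
Proof. by rewrite -testR mul1r /lmul_vec /= mulr1. Qed.
Lemma opB_vac b : opB b vac = b *: vac.
Proof.
apply: test_eq => -[[|[n x] l] [m c]] /=; last by rewrite -[RHS]/(b * 0) mulr0.
by case: m => [[|m]|m] //; rewrite -[RHS]/(b * 0) mulr0.
Qed.

Fact model_E_bimod b1 x b2 :
  model_E (model_in b1 * x * model_in b2) = b1 * model_E x * b2.
Proof.
rewrite /model_E.
have -> : fwd (model_in b1 * x * model_in b2) vac xi = b1 * fwd x vac xi * b2.
  rewrite -[LHS]/(fwd x (opB b1 vac) (bact b2 xi)) test_xi opB_vac.
  by rewrite [fwd x _](fwdZ x).
have -> : bwd (model_in b1 * x * model_in b2) vac xi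
    = star b2 * bwd x vac xi * star b1.
  rewrite -[LHS]/(bwd x (opB (star b2) vac) (bact (star b1) xi)) test_xi opB_vac.
  by rewrite [bwd x _](bwdZ x).
rewrite !starM !starK mulrA -mulrDl -mulrDr.
by rewrite scalerAl scalerAr.
Qed.

Definition free_model : ncpSpace B :=
  @NcpSpace C B model model_in model_E model_in_star model_E_star model_E_in
    model_E_bimod.

Definition model_u : free_model :=
  Opair testFun_nz (@opU_linear C B P theta thetaV 1) (@opU_linear C B P theta thetaV (-1)).
Definition model_P (x : P) : free_model :=
  Opair testFun_nz (opP_linear thetaK thetaVK x) (opP_linear thetaK thetaVK (star x)).

Lemma model_eq x y :
    (forall f v, fwd x f v = fwd y f v) -> (forall f v, bwd x f v = bwd y f v) ->
  x = y.
Proof. by move=> eq_f eq_b; apply: opair_eq => f; apply: test_eq => v. Qed.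

Lemma fwd_u f v : fwd model_u f v = f (uact 1 v). Proof. by []. Qed.
Lemma bwd_u f v : bwd model_u f v = f (uact (-1) v). Proof. by []. Qed.

Lemma model_P_star (x : P) : star x = x -> star (model_P x) = model_P x.
Proof. by move=> sx; apply: opair_eq => f; rewrite /= sx. Qed.

Lemma fwd_uX k f v : fwd (model_u ^+ k) f v = f (uact k v).
Proof.
elim: k f v => [|k IHk] f v; first by rewrite uact0.
by rewrite exprS [fwd _ _]fwd_mul IHk fwd_u -uactD.
Qed.
Lemma bwd_uX k f v : bwd (model_u ^+ k) f v = f (uact (- k%:Z) v).
Proof.
elim: k f v => [|k IHk] f v; first by rewrite uact0.
by rewrite exprS [bwd _ _]bwd_mul bwd_u IHk -uactD intS opprD addrC.
Qed.

Lemma model_u_left : star model_u * model_u = 1.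
Proof.
by apply: model_eq => f v; rewrite ?[fwd _ _]fwd_mul ?[bwd _ _]bwd_mul
  /= -uactD addNr uact0.
Qed.
Lemma model_u_right : model_u * star model_u = 1.
Proof.
by apply: model_eq => f v; rewrite ?[fwd _ _]fwd_mul ?[bwd _ _]bwd_mul
  /= -uactD addrN uact0.
Qed.

Lemma vac_uact k b : vac (uact k (bact b xi)) = if k == 0 then b else 0.
Proof. by rewrite /= addr0 mulr1; case: k => [[|k]|k]. Qed.

Lemma model_haar : haar_unitary model_u.
Proof.
split=> [||k k_gt0]; [exact: model_u_left|exact: model_u_right|].
rewrite -[LHS]/(2^-1 *: (fwd (model_u ^+ k) vac xi + star (bwd (model_u ^+ k) vac xi))).
rewrite fwd_uX bwd_uX -[xi](bact1 thetaK thetaVK) !vac_uact oppr_eq0.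
by case: k k_gt0 => //= k _; rewrite star0 addr0 scaler0.
Qed.

Lemma model_u_conj b : star model_u * model_in b * model_u = model_in (theta b).
Proof.
apply: model_eq => f v; rewrite ?[fwd _ _]fwd_mul ?[bwd _ _]bwd_mul
  -[LHS]/(f (uact (-1) (bact _ (uact 1 v)))) (bact_uact thetaK thetaVK)
  -uactD addNr uact0 //.
by rewrite /= theta_star.
Qed.
Lemma model_u_conjV b : model_u * model_in b * star model_u = model_in (thetaV b).
Proof.
rewrite -{1}[b]thetaVK -model_u_conj !mulrA model_u_right mul1r -mulrA.
by rewrite model_u_right mulr1.
Qed.

Lemma model_normalizes : normalizes model_u.
Proof.
by move=> b; split; [exists (thetaV b); apply: model_u_conjV
  |exists (theta b); apply: model_u_conj].
Qed.

(** [y] is the sum of the [u^k b] for [(k, b)] in [c]. *)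
Definition u_rep (y : model) (c : seq (int * B)) : Prop := forall f v,
  fwd y f v = \sum_(z <- c) f (uact z.1 (bact z.2 v)) /\
  bwd y f v = \sum_(z <- c) f (bact (star z.2) (uact (- z.1) v)).

Lemma gen_u_rep (y : free_model) :
  gen_alg (fun x : free_model => x = model_u \/ x = star model_u) y -> exists c, u_rep y c.
Proof.
elim=> {y} [b|_ [->|->]|x y _ [c xc] _ [d yd]|k x _ [c xc]|x y _ [c xc] _ [d yd]].
- by exists [:: (0, b)] => f v; rewrite !big_seq1 /= oppr0 !uact0.
- by exists [:: (1, 1)] => f v; rewrite !big_seq1 /= star1 !(bact1 thetaK thetaVK).
- exists [:: (- 1, 1)] => f v; rewrite !big_seq1 /= star1 !(bact1 thetaK thetaVK).
  by rewrite opprK.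
- exists (c ++ d) => f v; rewrite !big_cat fwd_add bwd_add !testFunD.
  by have [-> ->] := xc f v; have [-> ->] := yd f v.
- exists [seq (z.1, k *: z.2) | z <- c] => f v; rewrite !big_map fwd_scale bwd_scale.
  have [xf xb] := xc f v; rewrite !testFunZ xf xb !mulr_algl !scaler_sumr.
  split; apply: eq_bigr => z _ /=.
    rewrite -(test_bactZ thetaK thetaVK (opU z.1 f)) //.
  by rewrite starZ (test_bactZ thetaK thetaVK).
- exists [seq (z1.1 + z2.1, tw z2.1 z1.2 * z2.2) | z2 <- d, z1 <- c] => f v.
  rewrite fwd_mul bwd_mul !big_allpairs_dep /=; split.
    rewrite (yd _ v).1; apply: eq_bigr => z2 _; rewrite (xc f _).1.
    apply: eq_bigr => z1 _ /=; rewrite (bact_uact thetaK thetaVK) -uactD.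
    by rewrite -(bactM thetaK thetaVK).
  rewrite (xc _ v).2 exchange_big /=; apply: eq_bigr => z1 _; rewrite (yd f _).2.
  apply: eq_bigr => z2 _ /=; rewrite starM opprD [- z1.1 + _]addrC uactD.
  rewrite (bactM thetaK thetaVK) -(twist_star thetaK thetaVK theta_star).
  rewrite [bact (tw _ _) _](bact_uact thetaK thetaVK) -(twist_add thetaK thetaVK).
  by rewrite addNr.
Qed.

Definition nonzero_levels v : bool := all (fun z => z.1 != 0) v.1.
(** Reduced words only have their first letter at level zero, and it is then
    centered.  Only on such words do the products of the algebra of [p] and of
    [P] correspond. *)
Definition reduced_vec v : Prop :=
  if v.1 is z :: l then nonzero_levels (l, v.2) /\ (z.1 = 0 -> phi z.2 = 0) else True.

Definition p_rep (y : model) (x : P) : Prop := forall f v, reduced_vec v ->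
  fwd y f v = letter theta thetaV x f v /\ bwd y f v = letter theta thetaV (star x) f v.

Lemma nonzero_levels_bact b v : nonzero_levels (bact b v) = nonzero_levels v.
Proof. by case: v => [[|[n x] l] [m c]]. Qed.
Lemma nonzero_levels_reduced v : nonzero_levels v -> reduced_vec v.
Proof. by case: v => [[|[n x] l] t] //= /andP[/= /eqP n0 ?]; split. Qed.
Lemma reduced_cons (x : P) v : nonzero_levels v -> phi x = 0 -> reduced_vec (cons_vec (0, x) v).
Proof. by case: v => l t; split. Qed.

Lemma letterE (x : P) (g : vec -> B) v : nonzero_levels v ->
  letter theta thetaV x g v = g (cons_vec (0, center x) v) + g (bact (phi x) v).
Proof. by case: v => [[|[[[|n]|n] y] l] t]. Qed.
Lemma letterE0 (x y : P) (g : vec -> B) v :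
  letter theta thetaV x g (cons_vec (0, y) v)
  = g (cons_vec (0, center (x * y)) v) + g (bact (phi (x * y)) v).
Proof. by case: v. Qed.

Lemma reducedP v : reduced_vec v ->
  nonzero_levels v \/ exists (y : P) w, [/\ v = cons_vec (0, y) w, nonzero_levels w & phi y = 0].
Proof.
case: v => [[|[n y] l] t] /=; first by left.
move=> [nz_l y0]; have [n0|n0] := eqVneq n 0.
  by right; exists y, (l, t); rewrite n0; split=> //; apply: y0.
by left; rewrite /nonzero_levels /= n0.
Qed.

Lemma letter_ext (x : P) (g h : vec -> B) v :
    (forall w, reduced_vec w -> g w = h w) -> reduced_vec v ->
  letter theta thetaV x g v = letter theta thetaV x h v.
Proof.
move=> eq_gh /reducedP[nz_v|[y [w [-> nz_w y0]]]].
  rewrite !letterE // !eq_gh //; last exact: reduced_cons (center_E _).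
  by apply: nonzero_levels_reduced; rewrite nonzero_levels_bact.
rewrite !letterE0 !eq_gh //; last exact: reduced_cons (center_E _).
by apply: nonzero_levels_reduced; rewrite nonzero_levels_bact.
Qed.

(** Splitting [w] into its centered part and its expectation before
    multiplying by [x] makes no difference, because the functional is balanced
    over [B]. *)
Lemma letterM_core (x w : P) f v : nonzero_levels v ->
  letter theta thetaV x f (cons_vec (0, center w) v) + letter theta thetaV x f (bact (phi w) v)
  = f (cons_vec (0, center (x * w)) v) + f (bact (phi (x * w)) v).
Proof.
move=> nz_v; rewrite letterE0 letterE ?nonzero_levels_bact //.
rewrite -(testB0 f) -(bactM thetaK thetaVK) addrACA -(testD0 f).
rewrite -(test_bactD thetaK thetaVK) -centerMr -centerD -ncp_EMr -raddfD /=.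
by rewrite -mulrDr /center subrK.
Qed.

Lemma letterM (x y : P) f v : reduced_vec v ->
  letter theta thetaV y (letter theta thetaV x f) v = letter theta thetaV (x * y) f v.
Proof.
move=> /reducedP[nz_v|[z [w [-> nz_w _]]]].
  by rewrite (letterE y) // letterM_core // letterE.
by rewrite (letterE0 y) letterM_core // letterE0 mulrA.
Qed.

Lemma letter_in b f v : reduced_vec v -> letter theta thetaV (inP b) f v = f (bact b v).
Proof.
move=> /reducedP[nz_v|[z [w [-> nz_w z0]]]].
  by rewrite letterE // center_in ncp_E_in (test00 f) add0r.
rewrite letterE0 centerMl ncp_EMl z0 mulr0 center_id // (test_bact0 thetaK thetaVK).
by rewrite addr0; case: w {nz_w}.
Qed.

Lemma letterZD k (x y : P) f v : reduced_vec v ->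
  letter theta thetaV (k *: x + y) f v
  = k *: letter theta thetaV x f v + letter theta thetaV y f v.
Proof.
(* Linear in the element that the action puts at the head, whether or not it
   has been multiplied by a previous letter. *)
have core z1 z2 w : f (cons_vec (0, center (k *: z1 + z2)) w) + f (bact (phi (k *: z1 + z2)) w)
   = k *: (f (cons_vec (0, center z1) w) + f (bact (phi z1) w))
     + (f (cons_vec (0, center z2) w) + f (bact (phi z2) w)).
  have -> : phi (k *: z1 + z2) = k *: phi z1 + phi z2 by rewrite linearP.
  rewrite centerD centerZ (testL0 f).
  rewrite (test_bactD thetaK thetaVK) (test_bactZ thetaK thetaVK).
  by rewrite [k *: (_ + _)]scalerDr addrACA.
move=> /reducedP[nz_v|[z [w [-> nz_w _]]]]; first by rewrite !letterE.
by rewrite !letterE0 mulrDl -scalerAl.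
Qed.

Lemma p_rep_in b : p_rep (model_in b) (inP b).
Proof. by move=> f v red_v; rewrite -ncp_in_star !letter_in. Qed.
Lemma p_rep_mul y1 y2 (x1 x2 : P) : p_rep y1 x1 -> p_rep y2 x2 -> p_rep (y1 * y2) (x1 * x2).
Proof.
move=> r1 r2 f v red_v; rewrite fwd_mul bwd_mul starM; split.
  rewrite (r2 _ v red_v).1 -letterM //; apply: letter_ext => // w red_w.
  by rewrite (r1 f w red_w).1.
rewrite (r1 _ v red_v).2 -letterM //; apply: letter_ext => // w red_w.
by rewrite (r2 f w red_w).2.
Qed.
Lemma p_rep_P (x : P) : p_rep (model_P x) x.
Proof. by []. Qed.
Lemma p_rep_ZD k y1 y2 (x1 x2 : P) : p_rep y1 x1 -> p_rep y2 x2 ->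
  p_rep (k *: y1 + y2) (k *: x1 + x2).
Proof.
move=> r1 r2 f v red_v; rewrite starD starZ !letterZD //.
have [<- <-] := r1 f v red_v; have [<- <-] := r2 f v red_v.
by rewrite fwd_add bwd_add fwd_scale bwd_scale !testFunD !testFunZ !mulr_algl.
Qed.

Lemma gen_p_rep p (y : free_model) :
  gen_alg (fun x : free_model => x = model_P p) y -> exists x : P, p_rep y x.
Proof.
elim=> {y} [b|_ ->|x y _ [c xc] _ [d yd]|k x _ [c xc]|x y _ [c xc] _ [d yd]].
- by exists (inP b); apply: p_rep_in.
- by exists p; apply: p_rep_P.
- by exists (1 *: c + d); rewrite -[x]scale1r; apply: p_rep_ZD.
- exists (k *: c + inP 0); rewrite -[_ *: x]addr0 -[0](raddf0 model_in).
  by apply: p_rep_ZD => //; apply: p_rep_in.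
- by exists (c * d); apply: p_rep_mul.
Qed.

Lemma p_rep_E y (x : P) : p_rep y x -> model_E y = phi x.
Proof.
move=> yx; rewrite /model_E; have [-> ->] := yx vac xi I.
rewrite !letterE // ncp_E_star.
have vac_bact b : vac (bact b xi) = b by rewrite /lmul_vec /= mulr1.
rewrite !vac_bact [vac _](_ : _ = 0) // [vac _](_ : _ = 0) // !add0r.
by rewrite starK half_double.
Qed.

(** Centered elements, seen through their action: [y] sends a functional that
    vanishes on all the proper shifts of [w] to one that vanishes at [w]. *)
Definition u_null (y : model) : Prop := forall f w,
  (forall k b, k != 0 -> f (uact k (bact b w)) = 0) -> fwd y f w = 0.
(** For the algebra of [p], the words to be considered are those that have one
    more letter than [w], at level zero. *)
Definition p_null (y : model) : Prop := forall f w, nonzero_levels w ->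
  (forall x : P, f (cons_vec (0, x) w) = 0) -> fwd y f w = 0.

Lemma test_bact_sum (c : seq (int * B)) (Q : pred (int * B)) f w :
  \sum_(z <- c | Q z) f (bact z.2 w) = f (bact (\sum_(z <- c | Q z) z.2) w).
Proof.
elim/big_rec2: _ => [|z s1 s2 _ ->]; first by rewrite (test_bact0 thetaK thetaVK).
by rewrite (test_bactD thetaK thetaVK).
Qed.

(** The coefficient of [u^0] is the expectation of [y]. *)
Lemma gen_u_null (y : free_model) :
    gen_alg (fun x : free_model => x = model_u \/ x = star model_u) y ->
    model_E y = 0 ->
  u_null y /\ u_null (star y).
Proof.
move=> /gen_u_rep[c yc]; rewrite /model_E.
pose s := \sum_(z <- c | z.1 == 0) z.2.
have star_s : \sum_(z <- c | z.1 == 0) star z.2 = star s.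
  by rewrite /s; elim/big_rec2: _ => [|z s1 s2 _ ->]; rewrite ?star0 ?starD.
have [-> ->] := yc vac xi.
have -> : \sum_(z <- c) vac (uact z.1 (bact z.2 xi)) = s.
  by rewrite /s [RHS]big_mkcond; apply: eq_bigr => z _; rewrite vac_uact.
have -> : \sum_(z <- c) vac (bact (star z.2) (uact (- z.1) xi)) = star s.
  rewrite -star_s [RHS]big_mkcond; apply: eq_bigr => z _.
  rewrite (bact_uact thetaK thetaVK) vac_uact oppr_eq0.
  by have [->|//] := eqVneq z.1 0.
rewrite starK half_double => s0; split=> f w f0.
  rewrite (yc f w).1 (bigID (fun z => z.1 == 0)) /= [X in _ + X]big1 ?addr0.
    under eq_bigr => z /eqP-> do rewrite uact0.
    by rewrite test_bact_sum -/s s0 (test_bact0 thetaK thetaVK).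
  by move=> z; apply: f0.
rewrite -[fwd _ _]/(bwd y f) (yc f w).2 (bigID (fun z => z.1 == 0)) /=.
rewrite [X in _ + X]big1 ?addr0.
  under eq_bigr => z /eqP-> do rewrite oppr0 uact0.
  rewrite (_ : \sum_(z <- c | z.1 == 0) f (bact (star z.2) w)
    = \sum_(z <- [seq (z.1, star z.2) | z <- c] | z.1 == 0) f (bact z.2 w)).
    rewrite (test_bact_sum _ (fun z => z.1 == 0)) big_map star_s s0 star0.
    by rewrite (test_bact0 thetaK thetaVK).
  by rewrite big_map.
by move=> z z0; rewrite (bact_uact thetaK thetaVK); apply: f0; rewrite oppr_eq0.
Qed.

Lemma gen_p_null p (y : free_model) :
    gen_alg (fun x : free_model => x = model_P p) y -> model_E y = 0 ->
  p_null y /\ p_null (star y).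
Proof.
move=> /gen_p_rep[x yx]; rewrite (p_rep_E yx) => x0.
split=> f w nz_w f0; have [yf yb] := yx f w (nonzero_levels_reduced nz_w).
  by rewrite yf letterE // f0 add0r x0 (test_bact0 thetaK thetaVK).
rewrite -[fwd _ _]/(bwd y f) yb letterE // f0 add0r ncp_E_star x0 star0.
by rewrite (test_bact0 thetaK thetaVK).
Qed.

(** The vectors obtained from the vacuum by a reduced word whose leading letter
    is in the algebra of [p] if [t] holds, and is a power of [u] otherwise. *)
Definition starts (t : bool) v : Prop :=
  if t then exists (x : P) w, v = cons_vec (0, x) w /\ nonzero_levels w
  else exists k b w, [/\ v = uact k (bact b w), k != 0
                        & w = xi \/ exists (x : P) w', w = cons_vec (0, x) w' /\ nonzero_levels w'].

Lemma starts_nz v : starts false v -> nonzero_levels v.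
Proof.
move=> [k [b [w [-> k0 [->|[x [w' [-> nz_w']]]]]]]] //.
by rewrite /nonzero_levels /= addr0 k0.
Qed.

Lemma vac_starts t v : starts t v -> vac v = 0.
Proof.
case: t => [[x [w [-> _]]] //|[k [b [w [-> k0 [->|[x [w' [-> _]]]]]]]] //].
by rewrite vac_uact (negPf k0).
Qed.

Definition nulls (s : seq (bool * model)) : Prop :=
  (forall z, z \in s -> if z.1 then p_null z.2 else u_null z.2)
  /\ sorted (fun z1 z2 => z1.1 != z2.1) s.

(** Reading the word from right to left, each factor puts a new letter in front
    of the vector or shifts its level away from zero; no letters ever merge. *)
Lemma nulls_fwd s f : s != [::] -> nulls s ->
    (forall v, starts (head (false, 0) s).1 v -> f v = 0) ->
  fwd (\prod_(z <- s) z.2) f xi = 0.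
Proof.
elim: s f => [//|[t y] s IHs] f _ [s_null s_alt] /= f0; rewrite big_cons fwd_mul.
have y_null := s_null (t, y) (mem_head _ _).
case: s => [|[t' y'] s] in IHs s_null s_alt *.
  rewrite big_nil -[LHS]/(fwd y f xi).
  case: t {s_null s_alt} y_null f0 => /= y_null f0; apply: y_null => //.
    by move=> x; apply: f0; exists x, xi.
  by move=> k b k0; apply: f0; exists k, b, xi; split=> //; left.
have /= /andP[tt' s_alt'] := s_alt.
apply: IHs => //; first by split=> // z zs; apply: s_null; rewrite inE zs orbT.
move=> v /=; case: t t' {s_alt s_alt' s_null} y_null f0 tt' => [] [] //= y_null f0 _.
  move=> v_starts; apply: y_null => [|x]; first exact: starts_nz.
  by apply: f0; exists x, v; split=> //; apply: starts_nz.
move=> v_starts; apply: y_null => k b k0; apply: f0.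
by exists k, b, v; split=> //; right.
Qed.

Lemma star_prod (s : seq (bool * model)) :
  star (\prod_(z <- s) z.2) = \prod_(z <- rev [seq (z.1, star z.2) | z <- s]) z.2.
Proof.
elim: s => [|z s IHs]; first by rewrite !big_nil star1.
by rewrite big_cons starM IHs map_cons rev_cons -cats1 big_cat big_seq1.
Qed.

(** The vacuum functional vanishes on the nonempty reduced words; the second
    component of the product is the first component of the adjoint word. *)
Theorem model_free (p : P) :
  free_over (fun x : free_model => x = model_u \/ x = star model_u)
            (fun x => x = model_P p).
Proof.
apply/free_over_listP => s s_nil [s_gen s_alt].
have s_null z : z \in s -> if z.1 then p_null z.2 /\ p_null (star z.2)
    else u_null z.2 /\ u_null (star z.2).
  move=> zs; have [gz Ez] := s_gen z zs.
  by case: z.1 gz => gz; [apply: gen_p_null gz Ez|apply: gen_u_null].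
have fwd0 s' : s' != [::] -> nulls s' -> fwd (\prod_(z <- s') z.2) vac xi = 0.
  by move=> s'_nil ns'; apply: nulls_fwd => // v; apply: vac_starts.
rewrite -[LHS]/(model_E _) /model_E -[bwd _ _]/(fwd (star _) vac) star_prod.
rewrite fwd0 // ?add0r; last first.
  by split=> // z /s_null; case: z.1 => -[].
rewrite fwd0 ?star0 ?scaler0 //.
  by rewrite -size_eq0 size_rev size_map size_eq0.
split=> [z|].
  by rewrite mem_rev => /mapP[z' /s_null + ->] /=; case: z'.1 => -[].
rewrite rev_sorted sorted_map; congr sorted: s_alt; apply/funext => z1.
by apply/funext => z2 /=; rewrite eq_sym.
Qed.

End FreeProduct.

(** * Symmetrization by two-by-two matrices *)

Section Existence.
Variables (C : numClosedFieldType) (B : starAlgType C) (P : ncpSpace B).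
Variables (theta : {lrmorphism B -> B}) (thetaV : B -> B).
Hypotheses (thetaK : cancel theta thetaV) (thetaVK : cancel thetaV theta).
Hypothesis theta_star : forall b, theta (star b) = star (theta b).
Local Notation At := (free_model P thetaK thetaVK).
Local Notation mP := (model_P thetaK thetaVK).

Lemma p_rep_word (xs : seq P) bs :
  p_rep (word (A := At) (map mP xs) bs) (word xs bs).
Proof.
elim: xs bs => [|x xs IHx] bs.
  have e1 : model_in P theta thetaV 1 = 1 := rmorph1 (ncp_in At).
  by have := p_rep_in thetaK thetaVK (P := P) 1; rewrite e1 [ncp_in P 1]rmorph1.
case: bs => [|b bs] //=.
have px := p_rep_P thetaK thetaVK x.
have pb := p_rep_in thetaK thetaVK (P := P) b.
exact: (p_rep_mul thetaK thetaVK (p_rep_mul thetaK thetaVK px pb) (IHx bs)).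
Qed.

(** Every self-adjoint element has a copy, with the same [B]-valued moments,
    that is free from a Haar unitary implementing [theta]. *)
Theorem haar_free_extension (p : P) : star p = p ->
  exists (A : ncpSpace B) (q u : A),
    [/\ q = star q,
        [/\ haar_unitary u, normalizes u
          & forall b, star u * ncp_in A b * u = ncp_in A (theta b)],
        free_over (fun x => x = u \/ x = star u) (fun x => x = q)
      & forall n bs, mom (upto n (fun=> q)) bs = mom (upto n (fun=> p)) bs].
Proof.
move=> p_star; exists At, (mP p), (model_u P thetaK thetaVK); split.
- by rewrite model_P_star.
- by split; [apply: model_haar|apply: model_normalizes|apply: model_u_conj].
- exact: model_free.
- move=> n bs; have := p_rep_E (p_rep_word (upto n (fun=> p)) bs).
  by rewrite /upto -map_comp => word_E; apply: word_E.
Qed.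
End Existence.

(** An alias, since matrices with entries in [A] already have a scalar
    multiplication by [A]. *)
Definition mat2 (C : numClosedFieldType) (A : starAlgType C) : Type := 'M[A]_2.

Section Mat2.
Variables (C : numClosedFieldType) (A : starAlgType C).
Local Notation mat2 := (mat2 A).
HB.instance Definition _ := GRing.NzRing.copy mat2 'M[A]_2.

Definition mat2_scale (c : C) (x : mat2) : mat2 := map_mx ( *:%R c) x.
Fact mat2_scaleA c d x : mat2_scale c (mat2_scale d x) = mat2_scale (c * d) x.
Proof. by apply/matrixP => i j; rewrite !mxE scalerA. Qed.
Fact mat2_scale1 : left_id 1 mat2_scale.
Proof. by move=> x; apply/matrixP => i j; rewrite !mxE scale1r. Qed.
Fact mat2_scaleDr : right_distributive mat2_scale +%R.
Proof. by move=> c x y; apply/matrixP => i j; rewrite !mxE scalerDr. Qed.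
Fact mat2_scaleDl x : {morph mat2_scale^~ x : c d / c + d}.
Proof. by move=> c d; apply/matrixP => i j; rewrite !mxE scalerDl. Qed.
HB.instance Definition _ := GRing.Zmodule_isLmodule.Build C mat2
  mat2_scaleA mat2_scale1 mat2_scaleDr mat2_scaleDl.

Fact mat2_scaleAl (c : C) (x y : mat2) : c *: (x * y) = c *: x * y.
Proof.
apply/matrixP => i j; rewrite !mxE scaler_sumr.
by apply: eq_bigr => k _; rewrite mxE scalerAl.
Qed.
HB.instance Definition _ := GRing.Lmodule_isLalgebra.Build C mat2 mat2_scaleAl.
Fact mat2_scaleAr (c : C) (x y : mat2) : c *: (x * y) = x * (c *: y).
Proof.
apply/matrixP => i j; rewrite !mxE scaler_sumr.
by apply: eq_bigr => k _; rewrite !mxE scalerAr.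
Qed.
HB.instance Definition _ := GRing.Lalgebra_isAlgebra.Build C mat2 mat2_scaleAr.

Definition mat2_star (x : mat2) : mat2 := map_mx (@star C A) (x^T)%R.
Fact mat2_starK : involutive mat2_star.
Proof. by move=> x; apply/matrixP => i j; rewrite !mxE starK. Qed.
Fact mat2_starD : {morph mat2_star : x y / x + y}.
Proof. by move=> x y; apply/matrixP => i j; rewrite !mxE starD. Qed.
Fact mat2_starM x y : mat2_star (x * y) = mat2_star y * mat2_star x.
Proof.
apply/matrixP => i j; rewrite !mxE (big_morph _ (@starD C A) (star0 A)).
by apply: eq_bigr => k _; rewrite !mxE starM.
Qed.
Fact mat2_starZ (c : C) x : mat2_star (c *: x) = c^* *: mat2_star x.
Proof. by apply/matrixP => i j; rewrite !mxE starZ. Qed.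
HB.instance Definition _ := Algebra_isStarAlgebra.Build C mat2
  mat2_starK mat2_starD mat2_starM mat2_starZ.
End Mat2.

Section Symmetrization.
Variables (C : numClosedFieldType) (B : starAlgType C) (A : ncpSpace B).
Variables (theta : {lrmorphism B -> B}) (thetaV : B -> B).
Hypotheses (thetaK : cancel theta thetaV) (thetaVK : cancel thetaV theta).
Hypothesis theta_star : forall b, theta (star b) = star (theta b).
Local Notation inA := (ncp_in A).
Local Notation M := (mat2 A).

Definition diag2 (x y : A) : M :=
  \matrix_(i, j) if i == j then (if i == 0 then x else y) else 0.
Definition antidiag2 (x y : A) : M :=
  \matrix_(i, j) if i == j then 0 else (if i == 0 then x else y).

Lemma ord2P (Q : 'I_2 -> Prop) : Q 0 -> Q 1 -> forall i, Q i.
Proof.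
move=> Q0 Q1 [[|[|//]] lti].
  by rewrite (_ : Ordinal _ = 0) //; apply: val_inj.
by rewrite (_ : Ordinal _ = 1) //; apply: val_inj.
Qed.

Lemma diag2M x y x' y' : diag2 x y * diag2 x' y' = diag2 (x * x') (y * y').
Proof.
by apply/matrixP; apply: ord2P; apply: ord2P; rewrite !mxE big_ord_recl big_ord1 !mxE /=
  ?(mul0r, mulr0, add0r, addr0).
Qed.
Lemma antidiag2_diag2 x y x' y' :
  antidiag2 x y * diag2 x' y' = antidiag2 (x * y') (y * x').
Proof.
by apply/matrixP; apply: ord2P; apply: ord2P; rewrite !mxE big_ord_recl big_ord1 !mxE /=
  ?(mul0r, mulr0, add0r, addr0).
Qed.
Lemma antidiag2M x y x' y' :
  antidiag2 x y * antidiag2 x' y' = diag2 (x * y') (y * x').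
Proof.
by apply/matrixP; apply: ord2P; apply: ord2P; rewrite !mxE big_ord_recl big_ord1 !mxE /=
  ?(mul0r, mulr0, add0r, addr0).
Qed.

(** This twisted embedding puts [thetaV] at every other argument of the moments
    of an antidiagonal matrix. *)
Definition mat2_in (b : B) : M := diag2 (inA b) (inA (thetaV b)).
Definition mat2_E (x : M) : B := ncp_E A (x 0 0).

Lemma eq_mat2 (x y : M) :
  [/\ x 0 0 = y 0 0, x 0 1 = y 0 1, x 1 0 = y 1 0 & x 1 1 = y 1 1] -> x = y.
Proof. by case=> *; apply/matrixP; apply: ord2P; apply: ord2P. Qed.

Let thetaVB x y : thetaV (x - y) = thetaV x - thetaV y.
Proof. by apply: (can_inj thetaK); rewrite rmorphB /= !thetaVK. Qed.

Fact mat2_in_additive : zmod_morphism mat2_in.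
Proof.
move=> b b'; apply: eq_mat2; rewrite !mxE /= oppr0 addr0.
by rewrite -!rmorphB /= -thetaVB.
Qed.
HB.instance Definition _ := GRing.isZmodMorphism.Build B M mat2_in mat2_in_additive.
Fact mat2_in_multiplicative : monoid_morphism mat2_in.
Proof.
split=> [|b b']; last by rewrite diag2M -!rmorphM /= -(thetaVM thetaK thetaVK).
by apply: eq_mat2; rewrite !mxE /= (thetaV1 thetaK thetaVK) rmorph1.
Qed.
HB.instance Definition _ := GRing.isMonoidMorphism.Build B M mat2_in mat2_in_multiplicative.
Fact mat2_in_scalable : scalable mat2_in.
Proof.
move=> c b; have thetaVZ : thetaV (c *: b) = c *: thetaV b.
  by apply: (can_inj thetaK); rewrite linearZ /= !thetaVK.
by apply: eq_mat2; rewrite !mxE /= thetaVZ !linearZ /= ?scaler0.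
Qed.
HB.instance Definition _ := GRing.isScalable.Build C B M *:%R mat2_in mat2_in_scalable.

Fact mat2_E_linear : linear mat2_E.
Proof. by move=> c x y; rewrite /mat2_E !mxE linearP. Qed.
HB.instance Definition _ := GRing.isLinear.Build C M B *:%R mat2_E mat2_E_linear.

Fact mat2_in_star b : mat2_in (star b) = star (mat2_in b).
Proof.
have thetaV_star : thetaV (star b) = star (thetaV b).
  by apply: (can_inj thetaK); rewrite thetaVK theta_star thetaVK.
by apply: eq_mat2; rewrite !mxE /= ?star0 thetaV_star !ncp_in_star.
Qed.
Fact mat2_E_star x : mat2_E (star x) = star (mat2_E x).
Proof. by rewrite /mat2_E !mxE ncp_E_star. Qed.
Fact mat2_E_in b : mat2_E (mat2_in b) = b.
Proof. by rewrite /mat2_E !mxE /= ncp_E_in. Qed.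
Fact mat2_E_bimod b1 x b2 :
  mat2_E (mat2_in b1 * x * mat2_in b2) = b1 * mat2_E x * b2.
Proof.
rewrite /mat2_E !mxE big_ord_recl big_ord1 !mxE /= mulr0 addr0.
by rewrite big_ord_recl big_ord1 !mxE /= mul0r addr0 ncp_E_bimod.
Qed.

Definition mat2_space : ncpSpace B :=
  @NcpSpace C B M mat2_in mat2_E mat2_in_star mat2_E_star mat2_E_in mat2_E_bimod.

(** Words in this self-adjoint matrix alternate between [a] and its adjoint
    along each of the two nonzero entries. *)
Definition symmetrized (a : A) : mat2_space := antidiag2 (star a) a.

Lemma symmetrized_star a : star (symmetrized a) = symmetrized a.
Proof. by apply: eq_mat2; rewrite !mxE /= ?star0 ?starK. Qed.

Lemma word_symmetrized a n bs : size bs = n ->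
  word (upto n.+1 (fun=> symmetrized a)) bs
  = (if odd n then diag2 else antidiag2)
      (word (alt (star a) a n.+1) (altmap thetaV id bs))
      (word (alt a (star a) n.+1) (altmap id thetaV bs)) :> M.
Proof.
rewrite upto_const; elim: bs n => [|b bs IHb] [|n] // [sz_bs].
rewrite -[LHS]/(antidiag2 (star a) a * mat2_in b
  * (word (alt (symmetrized a) (symmetrized a) n.+1) bs : M)) IHb //.
rewrite antidiag2_diag2 oddS.
by case: odd; [rewrite antidiag2_diag2|rewrite antidiag2M].
Qed.

Lemma mom_symmetrized_even a n bs : odd n -> size bs = n ->
  mom (upto n.+1 (fun=> symmetrized a)) bs
  = mom (alt (star a) a n.+1) (altmap thetaV id bs).
Proof.
move=> odd_n sz_bs; rewrite /mom word_symmetrized // odd_n.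
by rewrite -[LHS]/(ncp_E A (diag2 _ _ _ _)) !mxE.
Qed.
Lemma mom_symmetrized_odd a n bs : ~~ odd n -> size bs = n ->
  mom (upto n.+1 (fun=> symmetrized a)) bs = 0.
Proof.
move=> /negPf even_n sz_bs; rewrite /mom word_symmetrized // even_n.
by rewrite -[LHS]/(ncp_E A (antidiag2 _ _ _ _)) !mxE raddf0.
Qed.

End Symmetrization.

(** * The four conditions *)

Section Assembly.
Variables (C : numClosedFieldType) (B : starAlgType C) (A : ncpSpace B) (a : A).
Variables (theta : {lrmorphism B -> B}) (thetaV : B -> B).
Hypotheses (thetaK : cancel theta thetaV) (thetaVK : cancel thetaV theta).
Hypothesis theta_star : forall b, theta (star b) = star (theta b).

Definition theta_symmetric : Prop := forall n bs, odd n -> size bs = n ->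
  mom (alt (star a) a n.+1) (altmap id theta bs)
  = theta (mom (alt a (star a) n.+1) (altmap theta id bs)).

(** Passage between arguments given as functions of the index, in even length,
    and arguments given as lists of odd size. *)
Lemma all_upto (Q : nat -> seq B -> Prop) :
  (forall n bs, odd n -> size bs = n -> Q n.+1 bs)
  <-> (forall k b, (0 < k)%N -> Q (2 * k)%N (upto (2 * k - 1) b)).
Proof.
split=> [Qn k b k_gt0|Qk n bs odd_n sz_bs].
  case: k k_gt0 => // k _; have -> : (2 * k.+1 = (2 * k).+2)%N by rewrite mulnS.
  by rewrite subn1; apply: Qn; rewrite ?size_upto //= mul2n odd_double.
have nE : (2 * (n.+1)./2 = n.+1)%N.
  by rewrite mul2n -[RHS]odd_double_half /= odd_n.
have bsE : upto n (fun i => nth 0 bs i.-1) = bs by rewrite -{1}sz_bs upto_nth.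
have := Qk (n.+1)./2 (fun i => nth 0 bs i.-1); rewrite nE subn1 [n.+1.-1]/= bsE.
by apply; rewrite half_gt0; case: n odd_n {nE sz_bs bsE}.
Qed.

Lemma theta_symmetricP :
  (forall (k : nat) (b : nat -> B), (0 < k)%N ->
        mom (upto (2 * k) (fun i => if odd i then star a else a))
            (upto (2 * k - 1) (fun i => if odd i then b i else theta (b i)))
        = theta (mom (upto (2 * k) (fun i => if odd i then a else star a))
            (upto (2 * k - 1) (fun i => if odd i then theta (b i) else b i))))
  <-> theta_symmetric.
Proof.
rewrite /theta_symmetric (all_upto (fun n bs => mom (alt (star a) a n) (altmap id theta bs)
  = theta (mom (alt a (star a) n) (altmap theta id bs)))).
split=> H k b k0; have := H k b k0; rewrite !upto_alt;
  by rewrite !(upto_altmap _ b id theta) !(upto_altmap _ b theta id).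
Qed.

Lemma theta_symmetric_twisted :
  theta_symmetric <-> forall n, (0 < n)%N -> ~~ odd n ->
    twisted theta (fun j b => mom (map (spow a) j) b) n.
Proof.
split=> [sym [|n] // _ /negPn odd_n b sz_b|tw n bs odd_n sz_bs].
  by rewrite !map_alt; apply: sym.
by have := tw n.+1 isT; rewrite /= odd_n => /(_ isT bs sz_bs); rewrite -!/(alt _ _ n.+1) !map_alt.
Qed.

Lemma beta_twisted :
  (forall (k : nat) (b : nat -> B), (0 < k)%N ->
        beta2 a k
          (upto (2 * k - 1) (fun i => if odd i then b i else theta (b i)))
        = theta (beta1 a k
          (upto (2 * k - 1) (fun i => if odd i then theta (b i) else b i))))
  <-> forall n, (0 < n)%N -> ~~ odd n -> twisted theta (cumulant (spow a)) n.
Proof.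
have upE n : upto n (fun i => odd i) = alt true false n.
  by rewrite -upto_alt; apply: eq_map => i; case: odd.
have upNE n : upto n (fun i => ~~ odd i) = alt false true n.
  by rewrite -upto_alt; apply: eq_map => i; case: odd.
have equiv := all_upto (fun n bs => cumulant (spow a) (alt true false n) (altmap id theta bs)
    = theta (cumulant (spow a) (alt false true n) (altmap theta id bs))).
split=> [H|H k b k0].
  move=> [|n] // _ /negPn odd_n b sz_b; apply: equiv.2 => // k b' k0.
  have := H k b' k0; rewrite /beta1 /beta2 upE upNE.
  by rewrite !(upto_altmap _ b' id theta) !(upto_altmap _ b' theta id).
rewrite /beta1 /beta2 upE upNE !(upto_altmap _ b id theta) !(upto_altmap _ b theta id).
by apply: equiv.1 => // n bs odd_n sz_bs; apply: H; rewrite //= odd_n.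
Qed.

Lemma r_diagonal_odd_mom : r_diagonal a -> forall j b, size b = (size j).-1 ->
  odd (size j) -> mom (map (spow a) j) b = 0.
Proof.
move=> rd j b sz_b odd_j; have j_gt0 : (0 < size j)%N by case: (size j) odd_j.
rewrite -[LHS]mulr1 -E_monom // r_diagonal_odd //.
by rewrite size_zip size_rcons sz_b prednK // minnn.
Qed.

Section Model.
Variables (At : ncpSpace B) (p u : At).
Hypothesis model : polar_model a theta p u.

Lemma model_same : same_monoms (u * p) a.
Proof. by case: model => _ _ _ /same_star_distributionP. Qed.

Lemma same_mom (A1 A2 : ncpSpace B) (a1 : A1) (a2 : A2) (e : bool) n bs :
  same_monoms a1 a2 -> size bs = n ->
  mom (alt (spow a1 e) (spow a1 (~~ e)) n.+1) bs = mom (alt (spow a2 e) (spow a2 (~~ e)) n.+1) bs.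
Proof.
move=> same sz_bs; have := same (zip (alt e (~~ e) n.+1) (rcons bs 1)).
by rewrite !E_monom ?size_alt // !mulr1 !map_alt.
Qed.

Lemma model_even_moments n bs : odd n -> size bs = n ->
  mom (alt (star a) a n.+1) bs = mom (alt p p n.+1) (altmap theta id bs)
  /\ mom (alt a (star a) n.+1) bs = thetaV (mom (alt p p n.+1) (altmap id theta bs)).
Proof.
move=> odd_n sz_bs; case: (model) => p_star [u_haar _ u_conj] u_p_free _.
rewrite -(same_mom true model_same sz_bs) -(same_mom false model_same sz_bs).
exact: (mom_polar thetaVK p_star u_haar u_conj u_p_free).
Qed.

Lemma model_r_diagonal : r_diagonal a.
Proof.
case: (model) => p_star [u_haar _ u_conj] u_p_free _.
apply: r_diagonal_transfer model_same _.
exact: (polar_r_diagonal thetaVK p_star u_haar u_conj u_p_free).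
Qed.

Lemma model_symmetric : theta_symmetric.
Proof.
move=> n bs odd_n sz_bs.
rewrite (model_even_moments odd_n _).1 ?size_altmap //.
rewrite (model_even_moments odd_n _).2 ?size_altmap // thetaVK.
by rewrite !altmap_comp.
Qed.

Lemma model_p_moments n bs : odd n -> size bs = n ->
  mom (alt p p n.+1) bs = mom (alt (star a) a n.+1) (altmap thetaV id bs).
Proof.
move=> odd_n sz_bs; rewrite (model_even_moments odd_n _).1 ?size_altmap //.
rewrite altmap_comp (eq_altmap (f' := id) (g' := id)) ?altmap_id //.
Qed.
End Model.

(** The copy of the symmetrized matrix that is free from a Haar unitary [u] has
    the moments that make [u p] agree with [a] on the even alternating words. *)
Theorem polar_model_exists : r_diagonal a -> theta_symmetric ->
  exists (At : ncpSpace B) (p u : At), polar_model a theta p u /\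
    forall k (b : nat -> B), mom (upto (2 * k).+1 (fun=> p)) (upto (2 * k) b) = 0.
Proof.
move=> rd sym.
pose P := mat2_space A thetaK thetaVK theta_star.
pose p0 : P := symmetrized thetaK thetaVK theta_star a.
have [At [p [u [p_star [u_haar u_norm u_conj] u_p_free p_mom]]]] :=
  haar_free_extension thetaK thetaVK theta_star (symmetrized_star thetaK thetaVK theta_star a).
have p_even n bs : odd n -> size bs = n ->
    mom (alt p p n.+1) bs = mom (alt (star a) a n.+1) (altmap thetaV id bs).
  by move=> odd_n sz_bs; rewrite -upto_const p_mom mom_symmetrized_even.
have idK : thetaV \o theta =1 id by move=> b; apply: thetaK.
have idVK : theta \o thetaV =1 id by move=> b; apply: thetaVK.
exists At, p, u; split; last first.
  by move=> k b; rewrite p_mom mom_symmetrized_odd ?size_upto // mul2n odd_double.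
split=> //; apply/same_star_distributionP.
have polar n bs := mom_polar thetaVK p_star u_haar u_conj u_p_free (n := n) (bs := bs).
apply: r_diagonal_unique => //.
- exact: (polar_r_diagonal thetaVK p_star u_haar u_conj u_p_free).
- move=> n bs odd_n sz_bs; rewrite (polar n bs odd_n sz_bs).2 p_even ?size_altmap //.
  (* The symmetry in (a) is used at the arguments that undo the twist of the
     matrix model. *)
  have := sym n (altmap thetaV id bs) odd_n; rewrite size_altmap => /(_ sz_bs).
  rewrite !altmap_comp => ->.
  by rewrite thetaK (eq_altmap (f' := id) (g' := id)) ?altmap_id.
- move=> n bs odd_n sz_bs; rewrite (polar n bs odd_n sz_bs).1 p_even ?size_altmap //.
  by rewrite altmap_comp (eq_altmap (f' := id) (g' := id)) ?altmap_id.
Qed.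
End Assembly.

Local Open Scope complex_scope.

Theorem proposition5p5 (R : realType) (B : starAlgType R[i]) (A : ncpSpace B)
    (a : A) (theta : {lrmorphism B -> B}) (thetaV : B -> B)
    (theta_star : forall b, theta (star b) = star (theta b))
    (thetaK : cancel theta thetaV) (thetaVK : cancel thetaV theta) :
  [<->
    (* (a) *)
    r_diagonal a /\
      (forall (k : nat) (b : nat -> B), (0 < k)%N ->
        mom (upto (2 * k) (fun i => if odd i then star a else a))
            (upto (2 * k - 1) (fun i => if odd i then b i else theta (b i)))
        = theta (mom (upto (2 * k) (fun i => if odd i then a else star a))
            (upto (2 * k - 1) (fun i => if odd i then theta (b i) else b i))));
    (* (b) *)
    r_diagonal a /\
      (forall (k : nat) (b : nat -> B), (0 < k)%N ->
        beta2 a k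
          (upto (2 * k - 1) (fun i => if odd i then b i else theta (b i)))
        = theta (beta1 a k
          (upto (2 * k - 1) (fun i => if odd i then theta (b i) else b i))));
    (* (c) *)
    exists (At : ncpSpace B) (p u : At),
      polar_model a theta p u /\
      (forall (k : nat) (b : nat -> B),
        mom (upto (2 * k).+1 (fun=> p)) (upto (2 * k) b) = 0);
    (* (d) *)
    exists (At : ncpSpace B) (p u : At), polar_model a theta p u
  ]
  /\
  (forall (At : ncpSpace B) (p u : At), polar_model a theta p u ->
    forall (k : nat) (b : nat -> B), (0 < k)%N ->
      mom (upto (2 * k) (fun=> p)) (upto (2 * k - 1) b)
      = mom (upto (2 * k) (fun i => if odd i then star a else a))
            (upto (2 * k - 1) (fun i => if odd i then thetaV (b i) else b i))).
Proof.
split; last first.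
  move=> At p u model; have [+ _] := all_upto (B := B) (fun n bs =>
    mom (upto n (fun=> p)) bs = mom (alt (star a) a n) (altmap thetaV id bs)).
  move=> moms k b k0; rewrite upto_alt (upto_altmap _ b thetaV id); apply: moms k0.
  by move=> n bs odd_n sz_bs; rewrite upto_const (model_p_moments thetaVK model).
tfae.
- move=> [rd /theta_symmetricP/theta_symmetric_twisted sym]; split=> //.
  by apply/beta_twisted/(twisted_moments_cumulants theta (r_diagonal_odd_mom rd)).
- move=> [rd /beta_twisted sym]; apply: polar_model_exists => //.
  apply/theta_symmetric_twisted.
  exact/(twisted_moments_cumulants theta (r_diagonal_odd_mom rd)).
- by move=> [At [p [u [model _]]]]; exists At, p, u.
- move=> [At [p [u model]]]; split; first exact: model_r_diagonal thetaVK _ _ _ model.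
  exact/theta_symmetricP/(model_symmetric thetaVK model).
Qed.
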